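(* Let $q$ be a left-invariant pseudo-Riemannian metric on $\mathrm{SL}(2,\mathbb{R})$ whose associated isomorphism $\Phi$ is diagonalizable (over $\mathbb{R}$), with Lax vector field $$E=a z_2z_3\frac{\partial}{\partial z_1}+b z_1z_3\frac{\partial}{\partial z_2}+c z_1z_2\frac{\partial}{\partial z_3},\qquad a=\nu_2-\nu_3,\quad b=\nu_3-\nu_1,\quad c=\nu_2-\nu_1=a+b,$$ on $\mathbb{R}^3$, and assume $ab>0$. In $\mathbb{RP}(2)$ put $q_x=[0:0:1]$, $q_y=[0:1:0]$, $q_u=[1:0:0]$, and let $p_1,p_2,p_3,p_4$ be the four points $[\pm\sqrt{a/c}:\pm\sqrt{b/c}:1]$. Let $L\subset\mathbb{R}^3\setminus\{0\}$ be a trajectory of $E$ and let $L_\infty$ be its image under the projection $(z_1,z_2,z_3)\mapsto[z_1:z_2:z_3]\in\mathbb{RP}(2)$. The geodesic associated with $L$ is complete if $L_\infty$ coincides with one of the points $q_x,q_y,q_u$, and is incomplete in all the other cases. An incomplete geodesic is $\mathbb{R}^+$-complete or $\mathbb{R}^-$-complete if and only if $L_\infty$ joins a point $p_i$ to a point $q_j$ ($j\in\{x,y,u\}$) or reduces to one of the points $p_i$.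
   Context: Let $B(x,y)=2\,\mathrm{Tr}(xy)$ on $\mathfrak{sl}(2,\mathbb{R})$ (one half of the Killing form). The associated isomorphism of $q$ is the unique $B$-self-adjoint linear isomorphism $\Phi$ with $q(x,y)=B(\Phi x,y)$. When $\Phi$ is diagonalizable, one fixes a basis $(v_1,v_2,v_3)$ of eigenvectors of $\Phi$ with $B(v_1,v_1)=B(v_2,v_2)=-B(v_3,v_3)=1$, $B(v_i,v_j)=0$ for $i\neq j$, and $[v_1,v_2]=v_3$, $[v_1,v_3]=v_2$, $[v_2,v_3]=-v_1$; $\nu_i$ is the eigenvalue of $\Phi^{-1}$ on $v_i$, and $(z_1,z_2,z_3)$ are the coordinates of $z\in\mathfrak{sl}(2,\mathbb{R})$ in this basis. A curve $\gamma$ is a geodesic of $q$ iff $z(t)=\Phi(\gamma(t)^{-1}\dot\gamma(t))$ solves $\dot z=[z,\Phi^{-1}z]$, i.e. is an integral curve of $E$; maximal geodesics and corresponding maximal integral curves have the same interval of definition, and the geodesic associated with a trajectory $L$ is the one so corresponding to it. A geodesic is complete if its maximal interval of definition is $\mathbb{R}$, and $\mathbb{R}^+$-complete (resp. $\mathbb{R}^-$-complete) if this interval is unbounded above (resp. below). ''$L_\infty$ joins $p_i$ to $q_j$'' means that the curve $L_\infty$ is not a point and its two ends converge to $p_i$ and $q_j$ respectively. *)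

(* Defs.v *)
From HB Require Import structures.
From mathcomp Require Import all_boot all_order all_algebra.
From mathcomp Require Import sesquilinear generic_quotient.
From mathcomp Require Import all_classical all_reals all_analysis.

Set Implicit Arguments.
Unset Strict Implicit.
Unset Printing Implicit Defensive.

Import Order.TTheory GRing.Theory Num.Theory.
Import numFieldNormedType.Exports.

Local Open Scope classical_set_scope.
Local Open Scope ring_scope.
Local Open Scope quotient_scope.

Section LieAlgebra.
Variable R : realType.

Definition tr2 (A : 'M[R]_2) : R^o := \tr A.

Lemma tr2_is_linear : linear tr2.
Proof. by move=> k A B; rewrite /tr2 mxtraceD mxtraceZ. Qed.

HB.instance Definition _ :=
  GRing.isLinear.Build R 'M[R]_2 R^o _ tr2 tr2_is_linear.

Definition sl2V : {vspace 'M[R]_2} := lker (linfun tr2).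

Lemma mem_sl2V (A : 'M[R]_2) : (A \in sl2V) = (\tr A == 0).
Proof. by rewrite memv_ker lfunE. Qed.

Definition sl2 := subvs_of sl2V.

(* [vsproj sl2V : 'M[R]_2 -> sl2] inverts [vsval] on traceless matrices. *)
Definition sl2_bracket (x y : sl2) : sl2 :=
  vsproj sl2V (vsval x *m vsval y - vsval y *m vsval x).

Lemma sl2_bracketE (x y : sl2) :
  vsval (sl2_bracket x y) = vsval x *m vsval y - vsval y *m vsval x.
Proof. by rewrite vsprojK// mem_sl2V linearB /= mxtrace_mulC subrr. Qed.

Definition formB (x y : sl2) : R := 2 * \tr (vsval x *m vsval y).

(* A left-invariant pseudo-Riemannian metric on SL(2,R) is given by its value
   at the identity: a nondegenerate symmetric bilinear form [q] on sl(2,R), of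
   any signature. *)
Definition associated_isomorphism (q : {symmetric sl2}) (Phi : 'End(sl2)) :=
  [/\ lker Phi = 0%VS,
      forall x y, formB (Phi x) y = formB x (Phi y) &
      forall x y, q x y = formB (Phi x) y].

Definition has_eigenbasis (f : 'End(sl2)) :=
  exists X : seq sl2,
    basis_of fullv X /\
    forall x, x \in X -> exists k, f x = k *: x.

Definition adapted_basis (Phi : 'End(sl2)) (v1 v2 v3 : sl2)
    (nu1 nu2 nu3 : R) :=
  [/\ basis_of fullv [:: v1; v2; v3],
      [/\ (Phi^-1)%VF v1 = nu1 *: v1, (Phi^-1)%VF v2 = nu2 *: v2
        & (Phi^-1)%VF v3 = nu3 *: v3],
      [/\ formB v1 v1 = 1, formB v2 v2 = 1 & formB v3 v3 = -1],
      [/\ formB v1 v2 = 0, formB v1 v3 = 0 & formB v2 v3 = 0] &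
      [/\ sl2_bracket v1 v2 = v3, sl2_bracket v1 v3 = v2
        & sl2_bracket v2 v3 = - v1]].

(* The Levi-Civita connection of [q] restricted to left-invariant vector fields,
   identified with elements of sl(2,R): metric and torsion-free.  For such
   fields [q x y] is a constant function, so its derivative disappears from the
   compatibility condition. *)
Definition levi_civita (q : {symmetric sl2})
    (nabla : {bilinear sl2 -> sl2 -> sl2}) :=
  (forall x y, nabla x y - nabla y x = sl2_bracket x y) /\
  (forall w x y, q (nabla w x) y + q x (nabla w y) = 0).

End LieAlgebra.

Section Curves.
Variable R : realType.

Definition open_interval (I : set R) :=
  [/\ open I, is_interval I & I !=set0].

(* [P f I]: the curve [f], of which only the values on [I] matter, is a
   solution with interval of definition [I]. *)
Definition maximal_on (T : Type) (P : (R -> T) -> set R -> Prop)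
    (f : R -> T) (I : set R) :=
  P f I /\
  forall g J, P g J -> I `<=` J -> (forall t, I t -> g t = f t) -> J = I.

(* Completeness of a geodesic in terms of its maximal interval [I]. *)
Definition geod_complete (I : set R) := I = setT.
Definition geod_complete_pos (I : set R) := ~ has_ubound I.
Definition geod_complete_neg (I : set R) := ~ has_lbound I.

(* The filters "t tends to the upper (lower) end of I", finite or infinite. *)
Definition upper_end (I : set R) : set_system R :=
  filter_from I (fun s => [set t | I t /\ s < t]).
Definition lower_end (I : set R) : set_system R :=
  filter_from I (fun s => [set t | I t /\ t < s]).

(* gamma^-1 gamma', an element of sl(2,R) when gamma stays in SL(2,R) *)
Definition velocity (gamma : R -> 'M[R]_2) (t : R) : sl2 R :=
  vsproj (sl2V R) (invmx (gamma t) *m 'D_1 gamma t).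

(* With gamma' = gamma x, the covariant derivative of gamma' along gamma is
   gamma (x' + nabla x x). *)
Definition geodesic (q : {symmetric (sl2 R)}) (gamma : R -> 'M[R]_2)
    (I : set R) :=
  open_interval I /\
  exists2 nabla, levi_civita q nabla &
    forall t, I t ->
      [/\ \det (gamma t) = 1, derivable gamma t 1 &
          is_derive t 1 (fun s => vsval (velocity gamma s))
            (- vsval (nabla (velocity gamma t) (velocity gamma t)))].

Definition maximal_geodesic (q : {symmetric (sl2 R)}) :=
  maximal_on (geodesic q).

Definition vec3 (x y z : R) : 'rV[R]_3 := \row_i [:: x; y; z]`_i.

Definition lax_field (a b c : R) (z : 'rV[R]_3) : 'rV[R]_3 :=
  let z1 := z 0 (inord 0) in
  let z2 := z 0 (inord 1) in
  let z3 := z 0 (inord 2) in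
  vec3 (a * z2 * z3) (b * z1 * z3) (c * z1 * z2).

Definition integral_curve (E : 'rV[R]_3 -> 'rV[R]_3) (z : R -> 'rV[R]_3)
    (I : set R) :=
  open_interval I /\ forall t, I t -> is_derive t 1 z (E (z t)).

Definition maximal_integral_curve (E : 'rV[R]_3 -> 'rV[R]_3) :=
  maximal_on (integral_curve E).

(* The coordinates of Phi (gamma^-1 gamma') in the basis (v1, v2, v3). *)
Definition lax_curve (Phi : 'End(sl2 R)) (v1 v2 v3 : sl2 R)
    (gamma : R -> 'M[R]_2) (t : R) : 'rV[R]_3 :=
  \row_i coord [tuple v1; v2; v3] i (Phi (velocity gamma t)).

End Curves.

Section ProjectivePlane.
Variable R : realType.

Definition nzvec : set 'rV[R]_3 := [set u | u != 0].

Definition same_line (u v : nzvec) : bool := (<[val u]> == <[val v]>)%VS.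

Lemma same_line_refl : reflexive same_line.
Proof. by move=> u; rewrite /same_line. Qed.

Lemma same_line_sym : symmetric same_line.
Proof. by move=> u v; rewrite /same_line eq_sym. Qed.

Lemma same_line_trans : transitive same_line.
Proof. by move=> v u w /eqP uv /eqP vw; rewrite /same_line uv vw. Qed.

Canonical same_line_equiv :=
  EquivRel same_line same_line_refl same_line_sym same_line_trans.

(* RP(2), with the quotient topology of R^3 minus the origin. *)
Definition RP2 : topologicalType := quotient_topology {eq_quot same_line}.

Lemma vec3_001_neq0 : vec3 0 0 1 \in nzvec.
Proof.
rewrite inE; apply/eqP => /matrixP /(_ 0 (inord 2)).
by rewrite !mxE inordK //= => /eqP; rewrite oner_eq0.
Qed.

(* The projection u |-> [u], with a junk value at u = 0. *)
Definition rp_class (u : 'rV[R]_3) : RP2 :=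
  \pi_(quotient_topology {eq_quot same_line})
    (insubd (SigSub vec3_001_neq0 : nzvec) u).

Lemma eq_rp_class (u v : 'rV[R]_3) : u != 0 -> v != 0 ->
  rp_class u = rp_class v <-> (<[u]> = <[v]>)%VS.
Proof.
move=> u0 v0; rewrite /rp_class; split.
  move=> /eqmodP; rewrite /= /same_line.
  by rewrite !val_insubd !mem_set//= => /eqP.
move=> uv; apply/eqmodP; rewrite /= /same_line.
by rewrite !val_insubd !mem_set//= uv.
Qed.

Definition qx : RP2 := rp_class (vec3 0 0 1).
Definition qy : RP2 := rp_class (vec3 0 1 0).
Definition qu : RP2 := rp_class (vec3 1 0 0).

Definition q_points : set RP2 := [set qx; qy; qu].

Definition p_points (a b c : R) : set RP2 :=
  [set p | exists s1 s2 : bool,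
     p = rp_class (vec3 ((-1) ^+ s1 * Num.sqrt (a / c))
                    ((-1) ^+ s2 * Num.sqrt (b / c)) 1)].

Definition reduces_to (S : set RP2) (p : RP2) := S = [set p].

(* The curve [ell], defined on [I], joins [p] to [p'].  A trajectory carries no
   preferred orientation here (if z is an integral curve of a quadratic field
   then so is t |-> - z (- t), which projects to the same curve, reversed), so
   the ends may be met in either order. *)
Definition joins (ell : R -> RP2) (I : set R) (p p' : RP2) :=
  (forall r, ~ reduces_to (ell @` I) r) /\
  ((ell @ lower_end I --> p /\ ell @ upper_end I --> p') \/
   (ell @ lower_end I --> p' /\ ell @ upper_end I --> p)).

End ProjectivePlane.
Arguments qx {R}.
Arguments qy {R}.
Arguments qu {R}.
Arguments q_points {R}.

(* Main.v *)
(* Rescaling z_l by mu_l turns the Lax field into y_i' = y_j y_k, for which the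
   differences y_i^2 - y_j^2 are constant.  Let y_i^2 be the smallest square.
   If it is strictly smaller than the two others, then |y_i'| >= y_i^2 + m with
   m > 0, so that atan forces the interval of definition to be bounded.  If
   y_i^2 = y_j^2, then y_j = +- y_i by uniqueness; either y_i = y_j = 0 (an
   equilibrium on an axis, i.e. a point q), or y_i never vanishes and 1/y_i
   satisfies h'' = K h with K = y_k^2 - y_i^2 >= 0.  In the latter case h is the
   restriction of a solution on R with exactly one zero, which is the only finite
   end of the maximal interval: K = 0 is the radial case (a point p), and for
   K > 0 the curve runs from p at the pole to q at infinity.
   A geodesic and the trajectory it follows are compared only through their
   common image L, on which the class above and the size of h and h' can be read
   off; no general existence theorem for linear equations is needed.  On an axis
   the velocity X of the geodesic is constant and X^2 is scalar, so the geodesic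
   extends to R by C(t) + S(t) X with C' = K S and S' = C. *)
Require Import Defs.
From mathcomp Require Import all_boot all_order all_algebra.
From mathcomp Require Import sesquilinear.
From mathcomp Require Import all_classical all_reals all_analysis.
From mathcomp Require Import ring lra zify.

Import Order.TTheory GRing.Theory Num.Theory.
Import numFieldNormedType.Exports.

Local Open Scope classical_set_scope.
Local Open Scope ring_scope.

Set Implicit Arguments.
Unset Strict Implicit.
Unset Printing Implicit Defensive.

(** * Linear and Riccati equations on an interval *)

Section RealAnalysis.
Context {R : realType}.
Implicit Types (f g h x w : R -> R) (I : set R) (s t df dg k K : R).

Lemma is_derive_funD f g t df dg :
  is_derive t 1 f df -> is_derive t 1 g dg ->
  is_derive t 1 (fun s => f s + g s) (df + dg).
Proof. by move=> ? ?; apply: is_deriveD. Qed.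

Lemma is_derive_funM f g t df dg :
  is_derive t 1 f df -> is_derive t 1 g dg ->
  is_derive t 1 (fun s => f s * g s) (df * g t + f t * dg).
Proof.
move=> ? ?; apply: is_derive_eq.
by rewrite /GRing.scale /= addrC mulrC.
Qed.

Lemma is_derive_funZ k f t df :
  is_derive t 1 f df -> is_derive t 1 (fun s => k * f s) (k * df).
Proof. by move=> ?; exact: is_deriveZ. Qed.

Lemma is_derive_funV f t df : f t != 0 ->
  is_derive t 1 f df -> is_derive t 1 (fun s => (f s)^-1) (- df / f t ^+ 2).
Proof.
move=> f0 fdf; have H := is_deriveV f0 fdf; apply: is_derive_eq.
by rewrite /GRing.scale /= !mulNr mulrC.
Qed.

Lemma is_derive_shift f t t0 df :
  is_derive (t - t0) 1 f df -> is_derive t 1 (fun s => f (s - t0)) df.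
Proof.
move=> fdf.
have H : is_derive t 1 (fun s : R => s - t0) (1 : R).
  by apply: is_derive_eq; rewrite subr0.
by apply: is_derive_eq; rewrite mulr1.
Qed.

(** The segment between [s] and [t] stays inside [I] because [I] is an interval; the two points may
    come in either order. *)
Lemma mvt_on f (df : R -> R) I s t :
  is_interval I -> (forall u, I u -> is_derive u 1 f (df u)) -> I s -> I t ->
  exists2 u, I u & f t - f s = df u * (t - s).
Proof.
move=> itvI fdf.
have main a b : a <= b -> I a -> I b ->
    exists2 u, I u & f b - f a = df u * (b - a).
  move=> ab Ia Ib.
  have sub u : u \in `[a, b]%R -> I u.
    by rewrite in_itv /= => uab; apply: (itvI a b).
  have [u uab ->] : exists2 c, c \in `[a, b]%R & f b - f a = df c * (b - a).
    apply: MVT_segment => //.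
      by move=> u uab; apply: fdf; apply: sub; exact: subset_itv_oo_cc.
    apply: derivable_within_continuous => u /sub Iu.
    exact: (@ex_derive _ _ _ _ _ _ _ (fdf u Iu)).
  by exists u => //; exact: sub.
move=> Is It; have [st|/ltW ts] := leP s t; first exact: main.
have [u Iu e] := main _ _ ts It Is; exists u => //.
by rewrite -opprB e -mulrN opprB.
Qed.

Lemma derive0_const f I s t : is_interval I ->
  (forall u, I u -> is_derive u 1 f 0) -> I s -> I t -> f s = f t.
Proof.
move=> itvI f0 Is It; have [u _] := mvt_on itvI f0 It Is.
by rewrite mul0r => /eqP; rewrite subr_eq0 => /eqP.
Qed.

Lemma is_interval_setT : is_interval (@setT R).
Proof. by []. Qed.

Lemma is_interval_segment (s t : R) : is_interval [set u | s <= u <= t].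
Proof.
move=> a b /= /andP[sa _] /andP[_ bt] c /andP[ac cb].
by rewrite (le_trans sa ac) (le_trans cb bt).
Qed.

Lemma derivable_bounded f (df : R -> R) s t : s <= t ->
  (forall u, s <= u <= t -> is_derive u 1 f (df u)) ->
  exists M : R, forall u, s <= u <= t -> `|f u| <= M.
Proof.
move=> st fdf.
have cf : {within `[s, t], continuous f}.
  apply: derivable_within_continuous => u; rewrite in_itv /= => /fdf ?.
  exact: ex_derive.
have [c1 _ fmax] := EVT_max st cf.
have [c2 _ fmin] := EVT_min st cf.
exists (`|f c1| + `|f c2|) => u ust.
have {}ust : u \in `[s, t]%R by rewrite in_itv.
have := fmax u ust; have := fmin u ust.
have := ler_norm (f c1); have := ler_norm (- f c2); rewrite normrN.
have := normr_ge0 (f c1); have := normr_ge0 (f c2).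
by rewrite ler_norml; move=> *; apply/andP; split; lra.
Qed.

Lemma nonvanishing_sign f (df : R -> R) I s t : is_interval I ->
  (forall u, I u -> is_derive u 1 f (df u)) ->
  (forall u, I u -> f u != 0) -> I s -> I t -> 0 < f s * f t.
Proof.
move=> itvI fdf fn0.
have main a b : a <= b -> I a -> I b -> 0 < f a * f b.
  move=> ab Ia Ib; rewrite ltNge; apply/negP => fab.
  have sub u : u \in `[a, b]%R -> I u.
    by rewrite in_itv /= => uab; apply: (itvI a b).
  have cf : {within `[a, b], continuous f}.
    apply: derivable_within_continuous => u /sub Iu.
    exact: (@ex_derive _ _ _ _ _ _ _ (fdf u Iu)).
  have [|c /sub Ic fc0] := @IVT _ f a b 0 ab cf.
    rewrite ge_min le_max.
    have := fn0 a Ia; have := fn0 b Ib.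
    by rewrite !neq_lt => /orP[] fb /orP[] fa; rewrite ?(ltW fa) ?(ltW fb) ?orbT //; nra.
  by have := fn0 c Ic; rewrite fc0 eqxx.
move=> Is It; have [st|/ltW ts] := leP s t; first exact: main.
by rewrite mulrC; exact: main.
Qed.

(* Gronwall: [f^2 exp(-+ 2 M t)] is monotone on each side of the zero, where
   [M] bounds [|g|]. *)
Lemma linear_ode_zero f g (dg : R -> R) I t0 : is_interval I ->
  (forall u, I u -> is_derive u 1 f (g u * f u)) ->
  (forall u, I u -> is_derive u 1 g (dg u)) ->
  I t0 -> f t0 = 0 -> forall t, I t -> f t = 0.
Proof.
move=> itvI fdf gdg It0 f0 t It.
(* [e] is the direction of time from [t0] to [t], so that one computation serves both sides of the
   zero. *)
have main (e : R) a b : `|e| = 1 -> a <= b -> I a -> I b ->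
    (forall c, c = t0 \/ c = t -> a <= c <= b) -> 0 <= e * (t - t0) -> f t = 0.
  move=> e1 ab Ia Ib ends et.
  have sub u : a <= u <= b -> I u by exact: itvI.
  have [M gM] : exists M : R, forall u, a <= u <= b -> `|g u| <= M.
    by apply: (@derivable_bounded g dg) => // u /sub; exact: gdg.
  pose E (u : R) : R := expR (- (2 * e * M) * u).
  have dE (u : R) : is_derive u 1 E (- (2 * e * M) * E u).
    have H := is_derive_funZ (- (2 * e * M)) (is_derive_id u 1).
    by rewrite /E; apply: (is_derive_eq (is_derive1_comp _ H)); ring.
  (* Since [|g| <= M], the factor [g - e M] is zero or of sign opposite to [e], so the nonnegative
     [phi] cannot grow when moving away from [t0], where it vanishes. *)
  pose phi u := f u * f u * E u.
  have dphi u : a <= u <= b ->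
      is_derive u 1 phi (2 * (g u - e * M) * (f u ^+ 2 * E u)).
    move=> /sub Iu; have Hf := fdf u Iu.
    by apply: (is_derive_eq (is_derive_funM (is_derive_funM Hf Hf) (dE u))); ring.
  have [u abu] := mvt_on (@is_interval_segment a b) dphi
    (ends t0 (or_introl erefl)) (ends t (or_intror erefl)).
  rewrite /phi f0 mul0r mul0r subr0 => phit.
  have q0 : 0 <= f u ^+ 2 * E u by rewrite mulr_ge0 ?sqr_ge0 ?expR_ge0.
  have := gM u abu; rewrite ler_norml => /andP[g1 g2].
  have Et : 0 < E t by exact: expR_gt0.
  have ph0 : f t * f t * E t <= 0.
    rewrite phit.
    move: e1 => /eqP; rewrite eqr_norml ler01 andbT => /orP[] /eqP ee;
      move: et; rewrite ee.
    - rewrite !mul1r => tt; move: (f u ^+ 2 * E u) q0 => q q0.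
      have : 0 <= (M - g u) * q by apply: mulr_ge0 => //; lra.
      by move=> ?; nra.
    - rewrite !mulN1r => tt; move: (f u ^+ 2 * E u) q0 => q q0.
      have : 0 <= (g u + M) * q by apply: mulr_ge0 => //; lra.
      by move=> ?; nra.
  apply/eqP; rewrite -sqrf_eq0 eq_le sqr_ge0 andbT expr2.
  by rewrite -(pmulr_lle0 _ Et).
have [tt|/ltW tt] := leP t0 t.
- apply: (main 1 t0 t) => //; rewrite ?normr1 //; first by move=> c [] ->; rewrite ?lexx ?tt.
  by rewrite mul1r subr_ge0.
- apply: (main (- 1) t t0) => //; rewrite ?normrN1 //; first by move=> c [] ->; rewrite ?lexx ?tt.
  by rewrite mulN1r opprB subr_ge0.
Qed.

(** The derivative of [atan (f / k)] is [k f' / (f^2 + k^2)], of absolute value at least [k], while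
    its values stay in an interval of length [pi]. *)
Lemma atan_bounded_interval f (df : R -> R) (k : R) I : 0 < k -> is_interval I ->
  (forall u, I u -> is_derive u 1 f (df u)) ->
  (forall u, I u -> f u ^+ 2 + k ^+ 2 <= `|df u|) ->
  forall s t, I s -> I t -> `|t - s| <= pi / k.
Proof.
move=> k0 itvI fdf fk s t Is It.
have dF (u : R) : I u -> is_derive u 1 (fun s : R => atan (k^-1 * f s))
    ((1 + (k^-1 * f u) ^+ 2)^-1 * (k^-1 * df u)).
  move=> Iu; have H := is_derive_funZ k^-1 (fdf u Iu).
  exact: (is_derive1_comp _ H).
have [u Iu e] := mvt_on itvI dF Is It.
have := atan_gtNpi2 (k^-1 * f t); have := atan_ltpi2 (k^-1 * f t).
have := atan_gtNpi2 (k^-1 * f s); have := atan_ltpi2 (k^-1 * f s).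
move=> h1 h2 h3 h4.
have : `|atan (k^-1 * f t) - atan (k^-1 * f s)| <= pi.
  by rewrite ler_norml; apply/andP; split; lra.
rewrite e normrM => H; rewrite ler_pdivlMr //; apply: le_trans H.
rewrite mulrC ler_wpM2r //.
have D0 : 0 < f u ^+ 2 + k ^+ 2 by rewrite ltr_wpDl ?sqr_ge0 // exprn_gt0.
have k0' : k != 0 by rewrite gt_eqF.
have -> : (1 + (k^-1 * f u) ^+ 2)^-1 * (k^-1 * df u) = k / (f u ^+ 2 + k ^+ 2) * df u.
  field; rewrite k0' /= gt_eqF //.
rewrite normrM gtr0_norm ?divr_gt0 // mulrAC ler_pdivlMr // ler_wpM2l ?(ltW k0) //.
exact: fk.
Qed.

(* The functions cosh(sqrt K t) and sinh(sqrt K t)/sqrt K, for K of any sign. *)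
Definition trig_pair (K : R) (C S : R -> R) :=
  [/\ forall t, is_derive t 1 C (K * S t), forall t, is_derive t 1 S (C t),
      C 0 = 1 & S 0 = 0].

(** Cosine and sine, exponentials, or [1] and the identity, according to the sign of [K]. A negative
    [K] can occur for geodesics with constant velocity, where [K] is minus a determinant. *)
Lemma trig_pair_ex K : exists C S, trig_pair K C S.
Proof.
have [K0|K0|->] := ltrgtP K 0.
- pose k : R := Num.sqrt (- K).
  have k2 : K = - (k * k) by rewrite -expr2 sqr_sqrtr ?opprK // oppr_ge0 ltW.
  have k0 : k != 0 by rewrite gt_eqF // sqrtr_gt0 oppr_gt0.
  have dk t : is_derive t 1 (fun s => k * s) k.
    by apply: (is_derive_eq (is_derive_funZ k (is_derive_id t 1))); rewrite mulr1.
  exists (fun t => cos (k * t)), (fun t => k^-1 * sin (k * t)); split.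
  + move=> t; apply: (is_derive_eq (is_derive1_comp (is_derive_cos _) (dk t))).
    by rewrite k2; field; exact: k0.
  + move=> t.
    apply: (is_derive_eq (is_derive_funZ _ (is_derive1_comp (is_derive_sin _) (dk t)))).
    by field; exact: k0.
  + by rewrite mulr0 cos0.
  + by rewrite mulr0 sin0 mulr0.
- pose k : R := Num.sqrt K.
  have k2 : K = k * k by rewrite -expr2 sqr_sqrtr // ltW.
  have k0 : k != 0 by rewrite gt_eqF // sqrtr_gt0.
  have dE (e : R) t : is_derive t 1 (fun s => expR (e * s)) (e * expR (e * t)).
    have H := is_derive_funZ e (is_derive_id t 1).
    by apply: (is_derive_eq (is_derive1_comp (is_derive_expR _) H)); ring.
  exists (fun t => 2^-1 * (expR (k * t) + expR (- k * t))).
  exists (fun t => (2 * k)^-1 * (expR (k * t) + - 1 * expR (- k * t))); split.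
  + move=> t.
    apply: (is_derive_eq (is_derive_funZ _ (is_derive_funD (dE k t) (dE (- k) t)))).
    by rewrite k2; field; exact: k0.
  + move=> t.
    apply: (is_derive_eq (is_derive_funZ _
      (is_derive_funD (dE k t) (is_derive_funZ _ (dE (- k) t))))).
    by field; exact: k0.
  + by rewrite !mulr0 expR0; field.
  + by rewrite !mulr0 expR0 mulN1r subrr mulr0.
- exists (fun=> 1), id; split => //; last by move=> t; exact: is_derive_id.
  by move=> t; rewrite mul0r; exact: is_derive_cst.
Qed.

Section Linear2.
Variables (K : R) (C S : R -> R).
Hypothesis CS : trig_pair K C S.

(** The left-hand side is a first integral of the system, with value [1] at time [0]. *)
Lemma trig_pair_sqr t : C t ^+ 2 - K * S t ^+ 2 = 1.
Proof.
case: CS => dC dS C0 S0.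
have -> : C t ^+ 2 - K * S t ^+ 2 = C t * C t + (- K) * (S t * S t) by ring.
transitivity (C 0 * C 0 + (- K) * (S 0 * S 0)); last by rewrite C0 S0; ring.
apply: (@derive0_const (fun t => C t * C t + (- K) * (S t * S t)) setT) => //.
move=> u _; apply: (is_derive_eq (is_derive_funD (is_derive_funM (dC u) (dC u))
  (is_derive_funZ _ (is_derive_funM (dS u) (dS u))))).
by ring.
Qed.

(** [A] and [B] apply the inverse fundamental matrix to [(h, h1)], so they have zero derivative and
    keep the values [h t0] and [h1 t0]. By [trig_pair_sqr] the determinant is [1], which solves back
    for [h] and [h1]. *)
Lemma linear2_sol (h h1 : R -> R) I t0 : is_interval I -> I t0 ->
  (forall t, I t -> is_derive t 1 h (h1 t)) ->
  (forall t, I t -> is_derive t 1 h1 (K * h t)) ->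
  forall t, I t -> h t = h t0 * C (t - t0) + h1 t0 * S (t - t0) /\
                   h1 t = h1 t0 * C (t - t0) + h t0 * (K * S (t - t0)).
Proof.
move=> itvI It0 dh dh1 t It; case: (CS) => dC dS C0 S0.
have dC' s : is_derive s 1 (fun u => C (u - t0)) (K * S (s - t0)).
  exact: is_derive_shift.
have dS' s : is_derive s 1 (fun u => S (u - t0)) (C (s - t0)).
  exact: is_derive_shift.
pose A s := h s * C (s - t0) + -1 * (h1 s * S (s - t0)).
pose B s := h1 s * C (s - t0) + - K * (h s * S (s - t0)).
have dA s : I s -> is_derive s 1 A 0.
  move=> Is; apply: (is_derive_eq (is_derive_funD (is_derive_funM (dh s Is) (dC' s))
    (is_derive_funZ _ (is_derive_funM (dh1 s Is) (dS' s))))).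
  by ring.
have dB s : I s -> is_derive s 1 B 0.
  move=> Is; apply: (is_derive_eq (is_derive_funD (is_derive_funM (dh1 s Is) (dC' s))
    (is_derive_funZ _ (is_derive_funM (dh s Is) (dS' s))))).
  by ring.
have := derive0_const itvI dA It0 It; have := derive0_const itvI dB It0 It.
rewrite /A /B subrr C0 S0 !mulr1 !mulr0 !addr0 => -> ->.
move: (trig_pair_sqr (t - t0)) => CS1.
split; rewrite -[LHS]mulr1 -{1}CS1; ring.
Qed.

End Linear2.

(** The closed formula of [linear2_sol] makes sense at every time, hence continues the solution from
    [I] to the whole line. *)
Lemma linear2_extend (K : R) (h h1 : R -> R) I t0 : is_interval I -> I t0 ->
  (forall t, I t -> is_derive t 1 h (h1 t)) ->
  (forall t, I t -> is_derive t 1 h1 (K * h t)) ->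
  exists g g1 : R -> R,
    [/\ forall t, is_derive t 1 g (g1 t), forall t, is_derive t 1 g1 (K * g t) &
        forall t, I t -> h t = g t /\ h1 t = g1 t].
Proof.
move=> itvI It0 dh dh1; have [C [S CS]] := trig_pair_ex K.
exists (fun t => h t0 * C (t - t0) + h1 t0 * S (t - t0)).
exists (fun t => h1 t0 * C (t - t0) + h t0 * (K * S (t - t0))).
case: (CS) => dC dS _ _; split; last exact: linear2_sol.
- move=> t; have dC' := is_derive_shift (dC (t - t0)).
  have dS' := is_derive_shift (dS (t - t0)).
  by apply: (is_derive_eq (is_derive_funD (is_derive_funZ _ dC') (is_derive_funZ _ dS'))); ring.
- move=> t; have dC' := is_derive_shift (dC (t - t0)).
  have dS' := is_derive_shift (dS (t - t0)).
  apply: (is_derive_eq (is_derive_funD (is_derive_funZ _ dC')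
    (is_derive_funZ _ (is_derive_funZ _ dS')))).
  by ring.
Qed.

(** [g] stands for the inverse of a component of the trajectory, continued to all of [R], and [ts]
    for the pole. The last clause says both that [ts] is the only zero and that [g] is large far
    from it. *)
Definition pole_pair (K : R) (g g1 : R -> R) (ts : R) :=
  [/\ forall t, is_derive t 1 g (g1 t), forall t, is_derive t 1 g1 (K * g t),
      forall t, g1 t ^+ 2 = 1 + K * g t ^+ 2, g ts = 0 &
      forall t, `|t - ts| <= `|g t| ].

(** As [K >= 0], the first integral forces [|g1| >= 1], so [g1] keeps its sign. Thus [g] is monotone
    with slope at least one in absolute value, and it crosses zero within distance [N = |g 0|] of
    the origin. *)
Lemma pole_pair_ex (K : R) (g g1 : R -> R) : 0 <= K ->
  (forall t, is_derive t 1 g (g1 t)) -> (forall t, is_derive t 1 g1 (K * g t)) ->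
  (forall t, g1 t ^+ 2 = 1 + K * g t ^+ 2) ->
  exists ts, pole_pair K g g1 ts.
Proof.
move=> K0 dg dg1 gg.
have g1n t : 1 <= `|g1 t|.
  rewrite -(@ler_pXn2r _ 2%N) ?nnegrE // expr1n real_normK ?num_real // gg.
  by rewrite lerDl mulr_ge0 // sqr_ge0.
have gl s t : `|t - s| <= `|g t - g s|.
  have [u _ ->] := @mvt_on g g1 setT s t is_interval_setT (fun u _ => dg u) I I.
  by rewrite normrM ler_peMl.
suff [ts gts] : exists ts, g ts = 0.
  by exists ts; split => // t; have := gl ts t; rewrite gts subr0.
have g10 t : g1 t != 0 by rewrite -normr_gt0 (lt_le_trans ltr01).
have sg s t : 0 < g1 s * g1 t.
  exact: (@nonvanishing_sign g1 _ setT s t is_interval_setT (fun u _ => dg1 u)).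
pose N : R := `|g 0|; have N0 : 0 <= N by exact: normr_ge0.
have cg : {within `[- N, N], continuous g}.
  by apply: derivable_within_continuous => u _; have := dg u => ?; exact: ex_derive.
have NN : - N <= N by lra.
have [|c _ gc] := @IVT _ g (- N) N 0 NN cg; last by exists c.
have [u1 _ e1] := @mvt_on g g1 setT 0 N is_interval_setT (fun u _ => dg u) I I.
have [u2 _ e2] := @mvt_on g g1 setT 0 (-N) is_interval_setT (fun u _ => dg u) I I.
have := sg u1 u2; have := g1n u1; have := g1n u2.
have [gN1 gN2] : g 0 <= N /\ - N <= g 0.
  by have := ler_norm (- g 0); rewrite normrN -/N => ?; split; [exact: ler_norm|lra].
rewrite ge_min le_max.
have [h1|h1] := ger0P (g1 u1); have [h2|h2] := ger0P (g1 u2) => a2 a1 sg12.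
- have p1 : 0 <= (g1 u1 - 1) * N by apply: mulr_ge0 => //; lra.
  have p2 : 0 <= (g1 u2 - 1) * N by apply: mulr_ge0 => //; lra.
  by apply/andP; split; apply/orP; [left|right]; nra.
- by nra.
- by nra.
- have p1 : 0 <= (- g1 u1 - 1) * N by apply: mulr_ge0 => //; lra.
  have p2 : 0 <= (- g1 u2 - 1) * N by apply: mulr_ge0 => //; lra.
  by apply/andP; split; apply/orP; [right|left]; nra.
Qed.

(* [1/x] solves the linear equation [h'' = K h], so it is defined on the whole
   line. *)
Lemma inverse_linear (K : R) x w I t0 : 0 <= K -> is_interval I -> I t0 ->
  (forall t, I t -> is_derive t 1 x (x t * w t)) ->
  (forall t, I t -> is_derive t 1 w (x t ^+ 2)) ->
  (forall t, I t -> x t != 0) ->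
  (forall t, I t -> w t ^+ 2 = x t ^+ 2 + K) ->
  exists g g1 ts, pole_pair K g g1 ts /\
    forall t, I t -> [/\ g t != 0, x t = (g t)^-1 & w t = - g1 t / g t].
Proof.
move=> K0 itvI It0 dx dw x0 xw.
have dh t : I t -> is_derive t 1 (fun s => (x s)^-1) (- 1 * (w t * (x t)^-1)).
  move=> It; apply: (is_derive_eq (is_derive_funV (x0 t It) (dx t It))).
  by field; exact: x0.
(* The relation [w^2 = x^2 + K] turns the second derivative of [1/x], which is [(w^2 - x^2)/x], into
   [K/x]. *)
have dh1 t : I t ->
    is_derive t 1 (fun s => - 1 * (w s * (x s)^-1)) (K * (x t)^-1).
  move=> It; apply: (is_derive_eq (is_derive_funZ _
    (is_derive_funM (dw t It) (is_derive_funV (x0 t It) (dx t It))))).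
  have -> : K = w t ^+ 2 - x t ^+ 2 by rewrite xw // addrC addKr.
  by field; exact: x0.
have [g [g1 [dg dg1 hg]]] := linear2_extend (t0 := t0) itvI It0 dh dh1.
have gg t : g1 t ^+ 2 = 1 + K * g t ^+ 2.
  have -> : g1 t ^+ 2 = (g1 t * g1 t + - K * (g t * g t)) + K * g t ^+ 2 by ring.
  congr (_ + _).
  (* The first integral is evaluated at [t0], where it equals [(w^2 - K)/x^2 = 1]. *)
  transitivity (g1 t0 * g1 t0 + - K * (g t0 * g t0)); last first.
    have [<- <-] := hg t0 It0; have -> : K = w t0 ^+ 2 - x t0 ^+ 2 by rewrite xw //; ring.
    by field; exact: x0.
  apply: (@derive0_const (fun t => g1 t * g1 t + - K * (g t * g t)) setT) => //.
  move=> u _; apply: (is_derive_eq (is_derive_funD (is_derive_funM (dg1 u) (dg1 u))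
    (is_derive_funZ _ (is_derive_funM (dg u) (dg u))))).
  by ring.
have [ts gts] := pole_pair_ex K0 dg dg1 gg.
exists g, g1, ts; split => // t It; have [e1 e2] := hg t It; split.
- by rewrite -e1 invr_eq0 x0.
- by rewrite -e1 invrK.
- by rewrite -e1 -e2; field; exact: x0.
Qed.

End RealAnalysis.

(** * Convergence in the projective plane *)

Section ProjectivePlane.
Context {R : realType}.
Implicit Types (u v w : 'rV[R]_3) (k : R).

Lemma rp_classZ k v : k != 0 -> v != 0 -> rp_class (k *: v) = rp_class v.
Proof.
move=> k0 v0; apply/eq_rp_class => //; first by rewrite scaler_eq0 negb_or k0.
apply: subv_anti; rewrite -!memvE rpredZ ?memv_line //=.
by apply/vlineP; exists k^-1; rewrite scalerA mulVf // scale1r.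
Qed.

Lemma rp_class_eqP u v : u != 0 -> v != 0 -> rp_class u = rp_class v ->
  exists2 k, k != 0 & u = k *: v.
Proof.
move=> u0 v0 /eq_rp_class => /(_ u0 v0) uv.
have /vlineP[k uk] : u \in <[v]>%VS by rewrite -uv memv_line.
by exists k => //; apply: contraNneq u0 => k0; rewrite uk k0 scale0r.
Qed.

(** The preimage of an open set of [RP2] among the nonzero vectors is the trace of an open [V] of
    R^3. Eventually [f t] lies in [V] and is nonzero, so the default value of [rp_class] at [0] does
    not interfere. *)
Lemma rp_cvg (T : Type) (F : set_system T) (f : T -> 'rV[R]_3) v : Filter F ->
  v != 0 -> (forall l, f t 0 l @[t --> F] --> v 0 l) ->
  rp_class (f t) @[t --> F] --> rp_class v.
Proof.
move=> FF v0 fv.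
have {}fv : f @ F --> v.
  apply/cvg_ballP => e e0; near=> t.
  split => // i j; rewrite ord1; move: j; near: t.
  by apply: filter_forall => j; have /cvg_ballP := fv j; apply.
have vn : v \in @nzvec R by rewrite inE.
move=> U; rewrite nbhsE => -[W [oW Wv] WU].
apply: (@filterS _ F _ (fun t => W (rp_class (f t)))) => //; first by move=> t; exact: WU.
have [V oV VO] : exists2 V : set 'rV[R]_3, open V &
    (set_val @^-1` V = [set x : @nzvec R | W (\pi_(RP2 R)%qT x)]) by exact: oW.
have Vv : V v.
  have -> : v = set_val (SigSub vn : @nzvec R) by [].
  rewrite -[V _]/((set_val @^-1` V) (SigSub vn : @nzvec R)) VO /=.
  move: Wv; rewrite /rp_class; congr (W (_ _)).
  by apply: val_inj; rewrite val_insubd vn.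
have nV : nbhs v V by exact: open_nbhs_nbhs.
have nv : nbhs v [set u | u != 0].
  apply: open_nbhs_nbhs; split => //.
  rewrite (_ : [set u | u != 0] = ~` [set 0]); last first.
    by apply/seteqP; split => x /= /eqP.
  by apply: closed_openC; exact: accessible_closed_set1 (hausdorff_accessible (@norm_hausdorff _ _)) _.
near=> t.
have Vt : V (f t) by near: t; exact: (fv _ nV).
have ft0 : f t != 0 by near: t; exact: (fv _ nv).
have ftn : f t \in @nzvec R by rewrite inE.
have : (set_val @^-1` V) (SigSub ftn : @nzvec R) by [].
rewrite VO /=; rewrite /rp_class; congr (W (_ _)).
by apply: val_inj; rewrite val_insubd ftn.
Unshelve. all: by end_near. Qed.

(** A scaling-invariant open set is saturated for the projection, so its image is an open
    neighbourhood of the limit, and membership in the image goes back to membership in [O]. *)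
Lemma rp_cvg_open (T : Type) (F : set_system T) (f : T -> 'rV[R]_3) v
    (O : set 'rV[R]_3) : Filter F ->
  open O -> (forall k u, k != 0 -> O u -> O (k *: u)) -> v != 0 -> O v ->
  F [set t | f t != 0] ->
  rp_class (f t) @[t --> F] --> rp_class v -> F [set t | O (f t)].
Proof.
move=> FF oO sO v0 Ov f0 fv.
have Oc u : u != 0 -> [set p : RP2 R | exists u, [/\ u != 0, O u & p = rp_class u]] (rp_class u) -> O u.
  move=> u0 [w [w0 Ow /(rp_class_eqP u0 w0)[k k0 ->]]].
  exact: sO.
have : F [set t | [set p : RP2 R | exists u, [/\ u != 0, O u & p = rp_class u]] (rp_class (f t))].
  apply: fv; apply: open_nbhs_nbhs; split; last by exists v.
  rewrite /open /= /quotient_open; exists O => //.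
  apply/seteqP; split => -[u hu] /=.
    move=> Ou; exists u; split => //; first by have := hu; rewrite inE.
    by rewrite /rp_class; congr (_ _); apply: val_inj; rewrite val_insubd hu.
  have u0 : u != 0 by have := hu; rewrite inE.
  move=> H; apply: Oc => //; move: H => [w [w0 Ow e]]; exists w; split => //.
  rewrite -e /rp_class; congr (_ _); apply: val_inj; by rewrite val_insubd hu.
by move: f0; apply: filterS2 => t; exact: Oc.
Qed.

(** Both sides are homogeneous of degree two: these are the scaling-invariant open cones that detect
    convergence to a coordinate axis through [rp_cvg_open]. *)
Lemma open_dominated (i j : 'I_3) (d : R) : open [set u : 'rV[R]_3 | (u 0 i) ^+ 2 < d * (u 0 j) ^+ 2].
Proof.
have cc l : continuous (fun u : 'rV[R]_3 => u 0 l) by exact: coord_continuous.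
have -> : [set u : 'rV[R]_3 | (u 0 i) ^+ 2 < d * (u 0 j) ^+ 2] =
   (fun u : 'rV[R]_3 => d * (u 0 j * u 0 j) - u 0 i * u 0 i) @^-1` [set x | 0 < x].
  by apply/seteqP; split => u /=; rewrite subr_gt0 !expr2.
apply: open_comp; last exact: open_gt.
move=> u _; apply: (@continuousB _ R^o _ (fun u => d * (u 0 j * u 0 j)) (fun u => u 0 i * u 0 i)).
  apply: (@continuousM _ _ (fun=> d) (fun u => u 0 j * u 0 j)); first exact: cst_continuous.
  by apply: (@continuousM _ _ (fun u => u 0 j) (fun u => u 0 j)); exact: cc.
by apply: (@continuousM _ _ (fun u => u 0 i) (fun u => u 0 i)); exact: cc.
Qed.

End ProjectivePlane.

(** * The system y_i' = y_j y_k *)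

Section Triples.
Implicit Types (i j k l : 'I_3).

Lemma I3_cases l : [\/ l = inord 0, l = inord 1 | l = inord 2].
Proof.
case: l => [[|[|[|//]]]] l3; [constructor 1|constructor 2|constructor 3];
  by apply: val_inj; rewrite /= inordK.
Qed.

Lemma uniq3E i j k : uniq [:: i; j; k] = [&& i != j, i != k & j != k].
Proof. by rewrite /= !inE negb_or andbT andbA. Qed.

Lemma uniq3_cases i j k l : uniq [:: i; j; k] -> [\/ l = i, l = j | l = k].
Proof.
rewrite uniq3E => /and3P[]; rewrite -!val_eqE /=.
case: i j k l => [i i3] [j j3] [k k3] [l l3] /= ij ik jk.
have [e|[e|e]] : l = i \/ l = j \/ l = k by move: i3 j3 k3 l3 ij ik jk; lia.
all: [> constructor 1|constructor 2|constructor 3]; exact: val_inj.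
Qed.

Lemma uniq3_swap i j k : uniq [:: i; j; k] -> uniq [:: j; i; k].
Proof. by rewrite !uniq3E (eq_sym j i) => /and3P[-> -> ->]. Qed.

Lemma uniq3_rot i j k : uniq [:: i; j; k] -> uniq [:: j; k; i].
Proof. by rewrite !uniq3E (eq_sym j i) (eq_sym k i) => /and3P[-> -> ->]. Qed.

Lemma sort3 (R : realDomainType) (f : 'I_3 -> R) :
  exists i j k, uniq [:: i; j; k] /\ f i <= f j <= f k.
Proof.
have U : uniq [:: inord 0; inord 1; inord 2 : 'I_3].
  by rewrite uniq3E -!val_eqE /= !inordK.
move: U; move: (inord 0) (inord 1) (inord 2) => i j k U.
wlog ij : i j U / f i <= f j.
  by move=> H; have [|/ltW] := leP (f i) (f j); apply: H => //; exact: uniq3_swap.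
have [jk|/ltW kj] := leP (f j) (f k); first by exists i, j, k; rewrite U ij jk.
have [ik|/ltW ki] := leP (f i) (f k).
  by exists i, k, j; rewrite ik kj; split => //; do 2 apply: uniq3_rot; apply: uniq3_swap; apply: uniq3_rot.
exists k, i, j; rewrite ki ij; split => //; do 2 apply: uniq3_rot; exact: U.
Qed.

End Triples.

Section Euler.
Context {R : realType}.
Implicit Types (y : 'I_3 -> R -> R) (p : 'I_3 -> R) (I : set R) (i j k l : 'I_3)
  (s t a b K : R).

(** Quantifying over all orderings of the indices makes the system invariant under permutations, so
    that [i] can be chosen to carry the smallest square. *)
Definition euler_curve y I := forall i j k, uniq [:: i; j; k] ->
  forall t, I t -> is_derive t 1 (y i) (y j t * y k t).

(** In this and the next two cases [i] carries the smallest square, once [a], [b] are positive and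
    [K] is nonnegative. The gaps [a], [b], [K] are constants of motion, hence parameters. *)
Definition on_axis i j k p := [/\ p i = 0, p j = 0 & p k != 0].

Definition strict_min a b i j k p :=
  p j ^+ 2 = p i ^+ 2 + a /\ p k ^+ 2 = p i ^+ 2 + b.

Definition tied_min K i j k p :=
  [/\ p i != 0, p j ^+ 2 = p i ^+ 2 & p k ^+ 2 = p i ^+ 2 + K].

(** All three squares have the same derivative, [2 y_i y_j y_k]. *)
Lemma euler_sqrB y I i j k s t : is_interval I -> euler_curve y I ->
  uniq [:: i; j; k] -> I s -> I t ->
  y j s ^+ 2 - y i s ^+ 2 = y j t ^+ 2 - y i t ^+ 2.
Proof.
move=> itvI ye U Is It.
have E u : y j u ^+ 2 - y i u ^+ 2 = y j u * y j u + - 1 * (y i u * y i u) by ring.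
rewrite !E.
apply: (@derive0_const _ (fun u => y j u * y j u + - 1 * (y i u * y i u)) I) => // u Iu.
have di := ye i j k U u Iu; have dj := ye j i k (uniq3_swap U) u Iu.
apply: (is_derive_eq (is_derive_funD (is_derive_funM dj dj)
  (is_derive_funZ _ (is_derive_funM di di)))).
by ring.
Qed.

(* [|y_i'| = |y_j y_k| >= y_i^2 + min(a, b)] *)
Lemma strict_min_bounded y I i j k a b : is_interval I -> euler_curve y I ->
  uniq [:: i; j; k] -> 0 < a -> 0 < b ->
  (forall t, I t -> strict_min a b i j k (fun l => y l t)) ->
  exists M : R, forall s t, I s -> I t -> `|t - s| <= M.
Proof.
move=> itvI ye U a0 b0 sm.
pose m := Num.min a b; have m0 : 0 < m by rewrite lt_min a0.
exists (pi / Num.sqrt m).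
apply: (@atan_bounded_interval _ (y i) (fun t => y j t * y k t)) => //.
- by rewrite sqrtr_gt0.
- by move=> u Iu; exact: ye.
- move=> u /sm[ej ek]; rewrite sqr_sqrtr ?(ltW m0) //.
  have M0 : 0 <= y i u ^+ 2 + m by rewrite addr_ge0 ?sqr_ge0 // ltW.
  rewrite -(ger0_norm M0) -ler_sqr ?nnegrE // !real_normK ?num_real //.
  rewrite exprMn ej ek expr2; apply: ler_pM => //; rewrite lerD2l ge_min lexx ?orbT //.
Qed.

(** At [t0] the two components agree up to a sign [e]. The difference [f = y_j - e y_i] satisfies
    the linear equation [f' = - e y_k f], so its zero at [t0] propagates. *)
Lemma euler_tied y I i j k t0 : is_interval I -> euler_curve y I ->
  uniq [:: i; j; k] -> I t0 -> y j t0 ^+ 2 = y i t0 ^+ 2 ->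
  exists2 e : R, e ^+ 2 = 1 & forall t, I t -> y j t = e * y i t.
Proof.
move=> itvI ye U It0 /eqP; rewrite eqf_sqr => eij.
have [e e1 e0] : exists2 e : R, e ^+ 2 = 1 & y j t0 = e * y i t0.
  by case/orP: eij => /eqP ->; [exists 1|exists (- 1)];
    rewrite ?sqrrN ?expr1n ?mul1r ?mulN1r.
exists e => // t It; apply/eqP; rewrite -subr_eq0; apply/eqP.
apply: (@linear_ode_zero _ (fun t => y j t - e * y i t) (fun t => - e * y k t)
  (fun t => - e * (y i t * y j t)) I t0) => //; last by rewrite e0 subrr.
- move=> u Iu; have di := ye i j k U u Iu; have dj := ye j i k (uniq3_swap U) u Iu.
  apply: (is_derive_eq (is_deriveB dj (is_derive_funZ e di))).
  rewrite -[X in X - _]mul1r -e1; ring.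
- move=> u Iu; apply: (is_derive_eq (is_derive_funZ (- e)
    (ye k i j (uniq3_rot (uniq3_rot U)) u Iu))).
  by [].
Qed.

(** With [y_j = e y_i] the equation for [y_i] becomes linear, [y_i' = (e y_k) y_i]. *)
Lemma euler_zero y I i j k (e : R) t0 : is_interval I -> euler_curve y I ->
  uniq [:: i; j; k] -> (forall t, I t -> y j t = e * y i t) -> I t0 ->
  y i t0 = 0 -> forall t, I t -> y i t = 0.
Proof.
move=> itvI ye U eij It0 y0.
apply: (@linear_ode_zero _ (y i) (fun t => e * y k t)
  (fun t => e * (y i t * y j t)) I t0) => //.
- move=> u Iu; apply: (is_derive_eq (ye i j k U u Iu)).
  by rewrite eij //; ring.
- move=> u Iu; exact: (is_derive_funZ e (ye k i j (uniq3_rot (uniq3_rot U)) u Iu)).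
Qed.

Lemma euler_classify y I : is_interval I -> I !=set0 -> euler_curve y I ->
  (forall t, I t -> exists l, y l t != 0) ->
  exists i j k, uniq [:: i; j; k] /\
  [\/ forall t, I t -> on_axis i j k (fun l => y l t),
      exists a b, [/\ 0 < a, 0 < b &
        forall t, I t -> strict_min a b i j k (fun l => y l t)] |
      exists2 K, 0 <= K & forall t, I t -> tied_min K i j k (fun l => y l t)].
Proof.
move=> itvI [t0 It0] ye y0.
have [i [j [k [U /andP[ij jk]]]]] := sort3 (fun l => y l t0 ^+ 2).
have U' : uniq [:: i; k; j] by apply: uniq3_swap; do 2 apply: uniq3_rot.
exists i, j, k; split => //.
(* The gaps between squares at [t0] persist, so the class at [t0] decides the class on all of
   [I]. *)
have dj t : I t -> y j t ^+ 2 = y i t ^+ 2 + (y j t0 ^+ 2 - y i t0 ^+ 2).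
  by move=> It; rewrite (euler_sqrB itvI ye U It0 It) addrC subrK.
have dk t : I t -> y k t ^+ 2 = y i t ^+ 2 + (y k t0 ^+ 2 - y i t0 ^+ 2).
  by move=> It; rewrite (euler_sqrB itvI ye U' It0 It) addrC subrK.
move: ij; rewrite le_eqVlt => /orP[/eqP ij|ij]; last first.
  constructor 2; exists (y j t0 ^+ 2 - y i t0 ^+ 2), (y k t0 ^+ 2 - y i t0 ^+ 2).
  by split; rewrite ?subr_gt0 ?(lt_le_trans ij) // => t It; split; [exact: dj|exact: dk].
have [e e1 eij] := euler_tied itvI ye U It0 (esym ij).
have [yi0|yi0] := eqVneq (y i t0) 0.
  have yi := euler_zero itvI ye U eij It0 yi0.
  constructor 1 => t It; split; rewrite ?eij ?yi ?mulr0 //.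
  have [l] := y0 t It; case: (uniq3_cases l U) => -> //; rewrite ?eij ?yi ?mulr0 ?eqxx //.
constructor 3; exists (y k t0 ^+ 2 - y i t0 ^+ 2); first by rewrite subr_ge0 ij.
move=> t It; split; last exact: dk.
  by apply: contraNneq yi0 => yit; apply/eqP; exact: (euler_zero itvI ye U eij It).
by rewrite eij // exprMn e1 mul1r.
Qed.

(** [e] is the sign in [y_j = e y_i]. The last formula comes from [e y_k] being the logarithmic
    derivative of [y_i = 1/g], that is [- g1 / g]. *)
Definition pole_form y I i j k (e K : R) (g g1 : R -> R) ts :=
  [/\ e ^+ 2 = 1, pole_pair K g g1 ts &
      forall t, I t -> [/\ g t != 0, y i t = (g t)^-1, y j t = e * (g t)^-1 &
                           y k t = - e * g1 t / g t]].

(** The pair [x = y_i], [w = e y_k] satisfies [x' = x w], [w' = x^2] and [w^2 = x^2 + K], which is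
    the setting of [inverse_linear]. *)
Lemma tied_min_pole y I i j k K : 0 <= K -> is_interval I -> I !=set0 ->
  euler_curve y I -> uniq [:: i; j; k] ->
  (forall t, I t -> tied_min K i j k (fun l => y l t)) ->
  exists e g g1 ts, pole_form y I i j k e K g g1 ts.
Proof.
move=> K0 itvI [t0 It0] ye U tm.
have [_ ij _] := tm t0 It0.
have [e e1 eij] := euler_tied itvI ye U It0 ij.
have [||||g [g1 [ts [pp H]]]] := @inverse_linear _ K (y i) (fun t => e * y k t) I t0 K0 itvI It0.
- move=> t It; apply: (is_derive_eq (ye i j k U t It)).
  by rewrite eij //; ring.
- move=> t It; apply: (is_derive_eq (is_derive_funZ e (ye k i j (uniq3_rot (uniq3_rot U)) t It))).
  by rewrite eij // -[RHS]mul1r -e1; ring.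
- by move=> t /tm[].
- by move=> t /tm[_ _]; rewrite exprMn e1 mul1r.
- exists e, g, g1, ts; split => // t It; have [h1 h2 h3] := H t It; split => //.
    by rewrite eij // h2.
  transitivity (e * (e * y k t)); first by rewrite mulrA -expr2 e1 mul1r.
  by rewrite h3; ring.
Qed.

Lemma pole_pair_avoids y I i j k e K g g1 ts :
  pole_form y I i j k e K g g1 ts -> ~ I ts.
Proof.
case=> _ [_ _ _ g0 _] H /H[]; by rewrite g0 eqxx.
Qed.

(** Converse of [tied_min_pole]: the explicit formulas solve the system wherever [g] is nonzero,
    which allows continuing a trajectory up to the pole. *)
Lemma pole_curve_euler i j k (e K : R) (g g1 : R -> R) ts I y :
  uniq [:: i; j; k] -> pole_form y I i j k e K g g1 ts -> open I ->
  euler_curve y I.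
Proof.
move=> U [e1 [dg dg1 gg _ _] H] oI.
(* The formulas for [y] hold on [I] only; openness of [I] makes them hold near each point, which is
   what derivatives need. *)
have near_eq (f h : R -> R) t (df : R) : I t -> (forall u, I u -> f u = h u) ->
    is_derive t 1 h df -> is_derive t 1 f df.
  move=> It fh; apply: near_eq_is_derive.
  by apply: filterS (open_nbhs_nbhs (conj oI It)) => u Iu; rewrite fh.
have dV t : I t -> is_derive t 1 (fun u => (g u)^-1) (- g1 t / g t ^+ 2).
  by move=> /H[gt0 _ _ _]; exact: is_derive_funV.
have di t : I t -> is_derive t 1 (y i) (- g1 t / g t ^+ 2).
  by move=> It; apply: near_eq (It) _ (dV t It) => u /H[].
have dj t : I t -> is_derive t 1 (y j) (e * (- g1 t / g t ^+ 2)).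
  by move=> It; apply: near_eq (It) _ (is_derive_funZ e (dV t It)) => u /H[].
have dk t : I t -> is_derive t 1 (y k) (e * (g t)^-1 ^+ 2).
  move=> It; have [gt0 _ _ _] := H t It.
  apply: near_eq (It) _ _; first by move=> u /H[_ _ _ ->]; reflexivity.
  apply: (is_derive_eq (is_derive_funM (is_derive_funZ (- e) (dg1 t)) (dV t It))).
  have -> : e * (g t)^-1 ^+ 2 = e * (g1 t ^+ 2 - K * g t ^+ 2) / g t ^+ 2.
    by rewrite gg addrK; field.
  by field.
move=> i' j' k' U' t It; have [gt0 ei ej ek] := H t It.
have Ei : - g1 t / g t ^+ 2 = y j t * y k t.
  by rewrite ej ek -[LHS]mul1r -e1; field.
have Ej : e * (- g1 t / g t ^+ 2) = y i t * y k t by rewrite ei ek; field.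
have Ek : e * (g t)^-1 ^+ 2 = y i t * y j t by rewrite ei ej; field.
have Di := is_derive_eq (di t It) Ei; have Dj := is_derive_eq (dj t It) Ej.
have Dk := is_derive_eq (dk t It) Ek.
move: U'; case: (uniq3_cases i' U) => ->; case: (uniq3_cases j' U) => ->;
  case: (uniq3_cases k' U) => ->; rewrite uniq3E ?eqxx ?andbF ?andFb //= => _ //;
  by apply: is_derive_eq; rewrite mulrC.
Qed.

End Euler.

(** * Ends of intervals, and scaling of the Lax field *)

Section Ends.
Context {R : realType}.
Implicit Types (I : set R) (d s t : R).

Lemma upper_end_filter I : I !=set0 -> Filter (upper_end I).
Proof.
move=> [t0 It0]; apply: filter_from_filter; first by exists t0.
move=> s t Is It; exists (Num.max s t).
  by rewrite maxEle; case: ifP.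
by move=> u /= [Iu]; rewrite gt_max => /andP[].
Qed.

Lemma lower_end_filter I : I !=set0 -> Filter (lower_end I).
Proof.
move=> [t0 It0]; apply: filter_from_filter; first by exists t0.
move=> s t Is It; exists (Num.min s t).
  by rewrite minEle; case: ifP.
by move=> u /= [Iu]; rewrite lt_min => /andP[].
Qed.

(** No point of an open set is its last one, so every generating set of the filter is inhabited. *)
Lemma upper_end_nonempty I U : open I -> upper_end I U -> exists2 t, I t & U t.
Proof.
move=> oI [s Is sU].
have [e /= e0 H] := (nbhs_ballP _ _).1 (open_nbhs_nbhs (conj oI Is)).
exists (s + e / 2); last apply: sU; last split.
- by apply: H; rewrite /ball /= opprD addrA subrr sub0r normrN gtr0_norm; lra.
- by apply: H; rewrite /ball /= opprD addrA subrr sub0r normrN gtr0_norm; lra.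
- by lra.
Qed.

Lemma lower_end_nonempty I U : open I -> lower_end I U -> exists2 t, I t & U t.
Proof.
move=> oI [s Is sU].
have [e /= e0 H] := (nbhs_ballP _ _).1 (open_nbhs_nbhs (conj oI Is)).
exists (s - e / 2); last apply: sU; last split.
- by apply: H; rewrite /ball /= opprD opprK addrA subrr add0r gtr0_norm; lra.
- by apply: H; rewrite /ball /= opprD opprK addrA subrr add0r gtr0_norm; lra.
- by lra.
Qed.

(** For [d = 1] the side after [ts], for [d = -1] the side before it: the sign treats both time
    directions at once. *)
Definition half_line d ts : set R := [set t | 0 < d * (t - ts)].

Lemma sqr_eq1 d : d ^+ 2 = 1 -> d = 1 \/ d = -1.
Proof. by move/eqP; rewrite sqrf_eq1 => /orP[] /eqP; [left|right]. Qed.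

Lemma half_line_open_interval d ts : d ^+ 2 = 1 -> open_interval (half_line d ts).
Proof.
move=> /sqr_eq1 dd; split.
- rewrite /half_line; case: dd => ->.
    rewrite (_ : [set t | _] = [set t | ts < t]); first exact: open_gt.
    by apply/seteqP; split => t /=; rewrite mul1r subr_gt0.
  rewrite (_ : [set t | _] = [set t | t < ts]); first exact: open_lt.
  by apply/seteqP; split => t /=; rewrite mulN1r oppr_gt0 subr_lt0.
- by move=> s t /= Is It u /andP[su ut]; move: Is It; rewrite /half_line /=; case: dd => ->; lra.
- by exists (ts + d); rewrite /half_line /= (_ : ts + d - ts = d); [|ring]; case: dd => ->; rewrite ?mulN1r; lra.
Qed.

Lemma interval_half_line I ts : is_interval I -> I !=set0 -> ~ I ts ->
  exists2 d, d ^+ 2 = 1 & I `<=` half_line d ts.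
Proof.
move=> itvI [t0 It0] nI.
have [t0s|t0s|e] := ltgtP t0 ts; last by rewrite e in It0.
- exists (-1); first by rewrite sqrrN expr1n.
  move=> t It; rewrite /half_line /= mulN1r oppr_gt0 subr_lt0 ltNge; apply/negP => st.
  by apply: nI; apply: (itvI t0 t) => //; rewrite st (ltW t0s).
- exists 1; first by rewrite expr1n.
  move=> t It; rewrite /half_line /= mul1r subr_gt0 ltNge; apply/negP => st.
  by apply: nI; apply: (itvI t t0) => //; rewrite st (ltW t0s).
Qed.

(** [near] is the end at the pole [ts] and [far] the infinite end; the sign [d] decides which of
    them is the lower one. *)
Lemma half_line_ends d ts : d ^+ 2 = 1 -> exists near far : set_system R,
  [/\ (near = lower_end (half_line d ts) /\ far = upper_end (half_line d ts)) \/
      (near = upper_end (half_line d ts) /\ far = lower_end (half_line d ts)),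
      forall e : R, 0 < e -> near [set t | half_line d ts t /\ `|t - ts| < e] &
      forall N : R, far [set t | half_line d ts t /\ N < `|t - ts| ] ].
Proof.
move=> /sqr_eq1 dd.
have H1 (e : R) : 0 < e -> half_line d ts (ts + d * e).
  by move=> e0; rewrite /half_line /= addrAC subrr add0r; case: dd => ->; lra.
have Hn t : half_line d ts t -> `|t - ts| = d * (t - ts).
  rewrite /half_line /=; case: dd => ->.
    by rewrite mul1r => /gtr0_norm.
  by rewrite mulN1r oppr_gt0 => /ltr0_norm.
case: (dd) => d1.
- exists (lower_end (half_line d ts)), (upper_end (half_line d ts)); split; first by left.
  + move=> e e0; exists (ts + d * e); first exact: H1.
    by move=> t [Ht tt]; split => //; rewrite Hn // d1; move: tt; rewrite d1; lra.
  + move=> N; exists (ts + d * (`|N| + 1)); first by apply: H1; have := normr_ge0 N; lra.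
    move=> t [Ht tt]; split => //; rewrite Hn // d1; move: tt; rewrite d1.
    by have := ler_norm N; lra.
- exists (upper_end (half_line d ts)), (lower_end (half_line d ts)); split; first by right.
  + move=> e e0; exists (ts + d * e); first exact: H1.
    by move=> t [Ht tt]; split => //; rewrite Hn // d1; move: tt; rewrite d1; lra.
  + move=> N; exists (ts + d * (`|N| + 1)); first by apply: H1; have := normr_ge0 N; lra.
    move=> t [Ht tt]; split => //; rewrite Hn // d1; move: tt; rewrite d1.
    by have := ler_norm N; lra.
Qed.

End Ends.

(* [y_l = mu_l z_l] turns the Lax field into the symmetric system
   [y_i' = y_j y_k]. *)
Definition is_scaling {R : realType} (a b c : R) (mu : 'I_3 -> R) :=
  [/\ forall l, mu l != 0,
      forall v i j k, uniq [:: i; j; k] ->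
        mu i * lax_field a b c v 0 i = (mu j * v 0 j) * (mu k * v 0 k) &
      forall v, v != 0 -> p_points a b c (rp_class v) <->
        forall i j, (mu i * v 0 i) ^+ 2 = (mu j * v 0 j) ^+ 2].

Section Scaling.
Context {R : realType}.
Implicit Types (a b c : R) (v : 'rV[R]_3).

Lemma vec3E (x1 x2 x3 : R) : [/\ vec3 x1 x2 x3 0 (inord 0) = x1,
  vec3 x1 x2 x3 0 (inord 1) = x2 & vec3 x1 x2 x3 0 (inord 2) = x3].
Proof. by rewrite /vec3 !mxE !inordK. Qed.

(** The first three equations determine the squares of nonzero solutions. Since [a b > 0] and
    [c = a + b], the numbers [a], [b], [c] share one sign [s]; the products are then positive, and
    giving every root the sign [s] satisfies the equations. *)
Lemma scaling_factors a b c : 0 < a * b -> c = a + b ->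
  exists m0 m1 m2 : R,
    [/\ a * m0 = m1 * m2, b * m1 = m0 * m2 & c * m2 = m0 * m1] /\
    [/\ m0 ^+ 2 = b * c, m1 ^+ 2 = a * c & m2 ^+ 2 = a * b].
Proof.
move=> ab0 ->; set c' := a + b.
have a0 : a != 0 by apply: contraTneq ab0 => ->; rewrite mul0r ltxx.
have bc0 : 0 < b * c' by rewrite /c' mulrDr mulrC ltr_wpDr // -expr2 sqr_ge0.
have ac0 : 0 < a * c' by rewrite /c' mulrDr ltr_wpDl // -expr2 sqr_ge0.
pose s := Num.sg a.
have s2 : s ^+ 2 = 1 by rewrite sqr_sg a0.
have sa (x : R) : 0 < a * x -> `|x| = s * x.
  move=> ax; rewrite /s; have [ap|an|az] := ltgtP a 0.
  - by rewrite ltr0_sg // mulN1r ltr0_norm // -(nmulr_rgt0 _ ap).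
  - by rewrite gtr0_sg // mul1r gtr0_norm // -(pmulr_rgt0 _ an).
  - by rewrite az eqxx in a0.
have aa : 0 < a * a by rewrite -expr2 exprn_even_gt0.
exists (s * Num.sqrt (b * c')), (s * Num.sqrt (a * c')), (s * Num.sqrt (a * b)).
have sq (u v x w : R) : 0 < u -> 0 < v -> u * v = x ^+ 2 * w -> 0 < a * x ->
    Num.sqrt u * Num.sqrt v = s * x * Num.sqrt w.
  move=> u0 v0 e ax; rewrite -sqrtrM ?(ltW u0) // e sqrtrM ?sqr_ge0 //.
  by rewrite sqrtr_sqr sa.
split; split.
- rewrite mulrACA -expr2 s2 mul1r (sq _ _ a (b * c')) //; ring.
- rewrite mulrACA -expr2 s2 mul1r (sq _ _ b (a * c')) //; ring.
- rewrite mulrACA -expr2 s2 mul1r (sq _ _ c' (a * b)) //; ring.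
- by rewrite exprMn s2 mul1r sqr_sqrtr // ltW.
- by rewrite exprMn s2 mul1r sqr_sqrtr // ltW.
- by rewrite exprMn s2 mul1r sqr_sqrtr // ltW.
Qed.

(** At the points [p] the rescaled squares are [bc (a/c)], [ac (b/c)] and [ab], all equal;
    conversely, equality of the squares fixes the ratios of the coordinates up to sign. *)
Lemma lax_scaling a b c : 0 < a * b -> c = a + b ->
  exists mu : 'I_3 -> R, is_scaling a b c mu.
Proof.
move=> ab0 cE; have [m0 [m1 [m2 [[e0 e1 e2] [q0 q1 q2]]]]] := scaling_factors ab0 cE.
have a0 : a != 0 by apply: contraTneq ab0 => ->; rewrite mul0r ltxx.
have b0 : b != 0 by apply: contraTneq ab0 => ->; rewrite mulr0 ltxx.
have bc0 : 0 < b * c by rewrite cE mulrDr mulrC ltr_wpDr // -expr2 sqr_ge0.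
have ac0 : 0 < a * c by rewrite cE mulrDr ltr_wpDl // -expr2 sqr_ge0.
have c0 : c != 0 by apply: contraTneq bc0 => ->; rewrite mulr0 ltxx.
have m00 : m0 != 0 by rewrite -sqrf_eq0 q0 gt_eqF.
have m10 : m1 != 0 by rewrite -sqrf_eq0 q1 gt_eqF.
have m20 : m2 != 0 by rewrite -sqrf_eq0 q2 gt_eqF.
pose mu (l : 'I_3) : R := [:: m0; m1; m2]`_l.
have [u0 u1 u2] : [/\ mu (inord 0) = m0, mu (inord 1) = m1 & mu (inord 2) = m2].
  by rewrite /mu !inordK.
have ac_ge : 0 <= a / c.
  by rewrite (_ : a / c = a * c / c ^+ 2); [rewrite divr_ge0 ?(ltW ac0) ?sqr_ge0|field].
have bc_ge : 0 <= b / c.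
  by rewrite (_ : b / c = b * c / c ^+ 2); [rewrite divr_ge0 ?(ltW bc0) ?sqr_ge0|field].
exists mu; split.
- by move=> l; case: (I3_cases l) => ->; rewrite ?u0 ?u1 ?u2.
- move=> v i j k; rewrite /lax_field.
  have [L0 L1 L2] := vec3E (a * v 0 (inord 1) * v 0 (inord 2))
    (b * v 0 (inord 0) * v 0 (inord 2)) (c * v 0 (inord 0) * v 0 (inord 1)).
  case: (I3_cases i) => ->; case: (I3_cases j) => ->; case: (I3_cases k) => ->;
    rewrite uniq3E ?eqxx ?andbF ?andFb //= => _; rewrite ?L0 ?L1 ?L2 ?u0 ?u1 ?u2.
  + by transitivity ((a * m0) * (v 0 (inord 1) * v 0 (inord 2))); [ring|rewrite e0; ring].
  + by transitivity ((a * m0) * (v 0 (inord 1) * v 0 (inord 2))); [ring|rewrite e0; ring].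
  + by transitivity ((b * m1) * (v 0 (inord 0) * v 0 (inord 2))); [ring|rewrite e1; ring].
  + by transitivity ((b * m1) * (v 0 (inord 0) * v 0 (inord 2))); [ring|rewrite e1; ring].
  + by transitivity ((c * m2) * (v 0 (inord 0) * v 0 (inord 1))); [ring|rewrite e2; ring].
  + by transitivity ((c * m2) * (v 0 (inord 0) * v 0 (inord 1))); [ring|rewrite e2; ring].
- move=> v v0; split.
  + move=> [s1 [s2]]; set p := vec3 _ _ _ => e.
    have [p0 p1 p2] : [/\ p 0 (inord 0) = (-1) ^+ s1 * Num.sqrt (a / c),
      p 0 (inord 1) = (-1) ^+ s2 * Num.sqrt (b / c) & p 0 (inord 2) = 1] by exact: vec3E.
    move: p p0 p1 p2 e => p p0 p1 p2 e.
    have pn : p != 0.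
      by apply/eqP => /matrixP /(_ 0 (inord 2)); rewrite p2 mxE => /eqP; rewrite oner_eq0.
    have [k _ vk] := rp_class_eqP v0 pn e.
    have H l : (mu l * v 0 l) ^+ 2 = k ^+ 2 * (a * b).
      rewrite vk mxE; case: (I3_cases l) => ->; rewrite ?u0 ?u1 ?u2 ?p0 ?p1 ?p2.
      * rewrite !exprMn q0 sqrr_sign sqr_sqrtr //; field; exact: c0.
      * rewrite !exprMn q1 sqrr_sign sqr_sqrtr //; field; exact: c0.
      * by rewrite !exprMn q2; ring.
    by move=> i j; rewrite !H.
  + move=> H.
    (* If the third coordinate vanished, all squares and hence [v] would vanish; so [v] can be
       normalised to third coordinate [1]. *)
    have v2 : v 0 (inord 2) != 0.
      apply: contraNneq v0 => v2; apply/eqP/rowP => l; rewrite mxE; apply/eqP.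
      have := H l (inord 2); rewrite v2 mulr0 expr0n /= => /eqP.
      rewrite sqrf_eq0 mulf_eq0 => /orP[|//].
      by case: (I3_cases l) => ->; rewrite ?u0 ?u1 ?u2 ?(negPf m00) ?(negPf m10) ?(negPf m20).
    have sgn (x y : R) : 0 <= y -> x ^+ 2 = y -> exists s : bool, x = (-1) ^+ s * Num.sqrt y.
      move=> y0 <-; rewrite sqrtr_sqr; exists (x < 0).
      by rewrite -{1}[x]mulr_sign_norm.
    have [s1 E1] : exists s : bool, v 0 (inord 0) / v 0 (inord 2) = (-1) ^+ s * Num.sqrt (a / c).
      apply: sgn => //; have := H (inord 0) (inord 2); rewrite u0 u2 !exprMn q0 q2 => h.
      apply: (@mulfI _ (b * c)); first by rewrite gt_eqF.
      by rewrite exprVn mulrA h; field; rewrite v2 c0.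
    have [s2 E2] : exists s : bool, v 0 (inord 1) / v 0 (inord 2) = (-1) ^+ s * Num.sqrt (b / c).
      apply: sgn => //; have := H (inord 1) (inord 2); rewrite u1 u2 !exprMn q1 q2 => h.
      apply: (@mulfI _ (a * c)); first by rewrite gt_eqF.
      by rewrite exprVn mulrA h; field; rewrite v2 c0.
    exists s1, s2; rewrite -E1 -E2.
    rewrite -(@rp_classZ _ (v 0 (inord 2))^-1) ?invr_eq0 //; congr rp_class.
    have [V0 V1 V2] := vec3E (v 0 (inord 0) / v 0 (inord 2)) (v 0 (inord 1) / v 0 (inord 2)) 1.
    apply/rowP => l; rewrite mxE.
    by case: (I3_cases l) => ->; rewrite ?V0 ?V1 ?V2 1?mulrC // mulfV.
Qed.

End Scaling.

(** * Entrywise differentiation of matrix-valued curves *)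

Section MatrixCurves.
Context {R : realType} {m n : nat}.

Lemma is_derive_coord (M : R -> 'M[R]_(m, n)) (t : R) (D : 'M[R]_(m, n)) i j :
  is_derive t 1 M D -> is_derive t 1 (fun s => M s i j) (D i j).
Proof.
move=> [dM <-]; apply: DeriveDef; first exact: (derivable_mxP _ _ _).1.
by rewrite derive_mx // mxE.
Qed.

Lemma is_derive_mx (M : R -> 'M[R]_(m, n)) (t : R) (D : 'M[R]_(m, n)) :
  (forall i j, is_derive t 1 (fun s => M s i j) (D i j)) -> is_derive t 1 M D.
Proof.
move=> dM; have drv : derivable M t 1.
  by apply/derivable_mxP => i j; have := dM i j => ?; exact: ex_derive.
apply: DeriveDef => //; rewrite derive_mx //; apply/matrixP => i j.
by rewrite mxE; have := dM i j => ?; exact: derive_val.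
Qed.

End MatrixCurves.

(** * Coordinate points of the projective plane, and convergence up to rescaling *)

Section ProjectiveMore.
Context {R : realType}.
Implicit Types (v : 'rV[R]_3).

Lemma vec3_delta (x1 x2 x3 : R) (l : 'I_3) :
  x1 = (inord 0 == l)%:R -> x2 = (inord 1 == l)%:R -> x3 = (inord 2 == l)%:R ->
  vec3 x1 x2 x3 = delta_mx 0 l.
Proof.
move=> e1 e2 e3; have [V0 V1 V2] := vec3E x1 x2 x3.
by apply/rowP => j; rewrite [RHS]mxE eqxx /=; case: (I3_cases j) => ->;
  rewrite ?V0 ?V1 ?V2.
Qed.

(** Indexing by the axis fits arguments up to permutation; [qx], [qy], [qu] belong to the indices 2,
    1, 0. *)
Lemma q_pointsP (r : RP2 R) :
  q_points r <-> exists k : 'I_3, r = rp_class (delta_mx 0 k).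
Proof.
split=> [|[k ->]].
  by move=> [[]|] ->; [exists (inord 2)|exists (inord 1)|exists (inord 0)];
    congr rp_class; apply: vec3_delta; rewrite -val_eqE /= !inordK.
case: (I3_cases k) => ->; [right|left; right|left; left];
  by congr rp_class; apply/esym/vec3_delta; rewrite -val_eqE /= !inordK.
Qed.

Lemma delta_neq0 (k : 'I_3) : (delta_mx 0 k : 'rV[R]_3) != 0.
Proof. by apply/eqP => /rowP /(_ k); rewrite !mxE !eqxx => /eqP; rewrite oner_eq0. Qed.

Lemma rp_class_deltaP v (k : 'I_3) : v != 0 ->
  rp_class v = rp_class (delta_mx 0 k) <-> forall i, i != k -> v 0 i = 0.
Proof.
move=> v0; split.
  move=> /(rp_class_eqP v0 (delta_neq0 k))[x _ ->] i ik.
  by rewrite !mxE (negPf ik) andbF mulr0.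
move=> H; have -> : v = v 0 k *: delta_mx 0 k.
  apply/rowP => i; rewrite !mxE eqxx /=; have [->|ik] := eqVneq i k.
    by rewrite mulr1.
  by rewrite mulr0 H.
rewrite rp_classZ ?delta_neq0 //; apply: contraNneq v0 => vk.
apply/eqP/rowP => i; rewrite mxE; have [->//|ik] := eqVneq i k; exact: H.
Qed.

(** At an end the vectors [f t] may diverge; a nonzero multiplier [h t] leaves their class unchanged
    and can make the coordinates converge. *)
Lemma rp_cvg_scaled (F : set_system R) (f : R -> 'rV[R]_3) (h : R -> R) v :
  Filter F -> v != 0 -> F [set t | h t != 0 /\ f t != 0] ->
  (forall l, h t * f t 0 l @[t --> F] --> v 0 l) ->
  rp_class (f t) @[t --> F] --> rp_class v.
Proof.
move=> FF v0 hf0 hv.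
have H : rp_class (h t *: f t) @[t --> F] --> rp_class v.
  apply: (@rp_cvg _ _ F (fun t => h t *: f t)) => // l.
  by rewrite (_ : (fun t => _) = (fun t => h t * f t 0 l)) //; apply/funext => t; rewrite mxE.
move=> U /H HU; change (F [set t | U (rp_class (f t))]).
have {}HU : F [set t | U (rp_class (h t *: f t))] := HU.
by move: hf0 HU; apply: filterS2 => t [h0 f0] /=; rewrite rp_classZ.
Qed.

End ProjectiveMore.

Lemma uniq3_ex (i : 'I_3) : exists j k, uniq [:: i; j; k].
Proof.
case: (I3_cases i) => ->; [exists (inord 1), (inord 2)|exists (inord 0), (inord 2)|exists (inord 0), (inord 1)];
  by rewrite uniq3E -!val_eqE /= !inordK.
Qed.

(** * Maximal trajectories *)

Section Dynamics.
Context {R : realType} {a b c : R} {mu : 'I_3 -> R}.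
Hypothesis muP : is_scaling a b c mu.
Local Notation E := (lax_field a b c).
Local Notation scaled z := (fun l t => mu l * z t 0 l).
Implicit Types (z w : R -> 'rV[R]_3) (I J : set R) (i j k l : 'I_3).

Lemma lax_euler z I : integral_curve E z I -> euler_curve (scaled z) I.
Proof.
case: muP => _ muE _ [_ dz] i j k U t It.
apply: (is_derive_eq (is_derive_funZ (mu i) (is_derive_coord 0 i (dz t It)))).
exact: muE.
Qed.

Lemma scaled_neq0 (v : 'rV[R]_3) : v != 0 -> exists l, mu l * v 0 l != 0.
Proof.
case: muP => mu0 _ _ v0; apply: contrapT => H.
move/eqP: v0; apply; apply/rowP => l; rewrite mxE; apply/eqP.
apply/negPn/negP => vl; apply: H; exists l.
by rewrite mulf_neq0.
Qed.

Lemma lax_classify z I : integral_curve E z I -> (forall t, I t -> z t != 0) ->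
  exists i j k, uniq [:: i; j; k] /\
  [\/ forall t, I t -> on_axis i j k (fun l => mu l * z t 0 l),
      exists a b, [/\ 0 < a, 0 < b &
        forall t, I t -> strict_min a b i j k (fun l => mu l * z t 0 l)] |
      exists2 K, 0 <= K & forall t, I t -> tied_min K i j k (fun l => mu l * z t 0 l)].
Proof.
move=> zI z0; case: (zI) => -[_ itvI In0] _.
apply: (@euler_classify _ (scaled z) I) => //; first exact: lax_euler.
by move=> t /z0; exact: scaled_neq0.
Qed.

Lemma on_axis_coord i j k (v : 'rV[R]_3) : uniq [:: i; j; k] ->
  on_axis i j k (fun l => mu l * v 0 l) -> forall l, l != k -> v 0 l = 0.
Proof.
case: muP => mu0 _ _ U [/eqP ei /eqP ej _] l lk.
move: ei ej; rewrite !mulf_eq0 !(negPf (mu0 _)) /= => /eqP ei /eqP ej.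
by move: lk; case: (uniq3_cases l U) => -> //; rewrite eqxx.
Qed.

(** The class with strict minimum is excluded: [strict_min_bounded] makes its interval bounded on
    both sides. *)
Lemma unbounded_classify w J : integral_curve E w J -> (forall t, J t -> w t != 0) ->
  ~ has_ubound J \/ ~ has_lbound J ->
  (exists k, forall t, J t -> forall l, l != k -> w t 0 l = 0) \/
  exists i j k K, [/\ uniq [:: i; j; k], 0 <= K &
    forall t, J t -> tied_min K i j k (fun l => mu l * w t 0 l)].
Proof.
move=> wJ w0 ub; have [i [j [k [U [H|[x [y [x0 y0 H]]]|[K K0 H]]]]]] := lax_classify wJ w0.
- by left; exists k => t /H; exact: on_axis_coord.
- exfalso; case: (wJ) => -[_ itvJ [t0 Jt0]] _.
  have [M HM] := strict_min_bounded itvJ (lax_euler wJ) U x0 y0 H.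
  case: ub; apply.
    exists (t0 + M) => t Jt; have := HM t0 t Jt0 Jt; have := ler_norm (t - t0); lra.
  exists (t0 - M) => t Jt; have := HM t t0 Jt Jt0; have := ler_norm (t0 - t); lra.
- by right; exists i, j, k, K.
Qed.

(** In the tied class the pole [ts] would be a time outside the interval of definition, which here
    is all of [R]. *)
Lemma complete_axis w : integral_curve E w setT -> (forall t, w t != 0) ->
  exists k, forall t l, l != k -> w t 0 l = 0.
Proof.
move=> wT w0.
have [|||] := unbounded_classify wT.
- by move=> t _.
- by left => -[x /(_ (x + 1) I)]; rewrite gerDl ler10.
- by move=> [k H]; exists k => t; exact: H.
- move=> [i [j [k [K [U K0 H]]]]]; exfalso.
  have [e [g [g1 [ts pf]]]] := tied_min_pole K0 is_interval_setT
    (ex_intro _ 0 I) (lax_euler wT) U H.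
  exact: (pole_pair_avoids pf).
Qed.

(** [I] misses the pole, so it lies on one side of it. The explicit formulas define a solution on
    that whole half-line which extends [z], and maximality gives equality. *)
Lemma pole_maximal z I i j k K : maximal_integral_curve E z I ->
  uniq [:: i; j; k] -> 0 <= K ->
  (forall t, I t -> tied_min K i j k (fun l => mu l * z t 0 l)) ->
  exists e g g1 ts d, [/\ d ^+ 2 = 1, I = half_line d ts &
    pole_form (scaled z) I i j k e K g g1 ts].
Proof.
move=> [zI zmax] U K0 H; case: (zI) => -[oI itvI In0] _.
have [e [g [g1 [ts pf]]]] := tied_min_pole K0 itvI In0 (lax_euler zI) U H.
have [d d1 IH] := interval_half_line itvI In0 (pole_pair_avoids pf).
exists e, g, g1, ts, d; split => //; apply/esym.
case: (pf) => e1 pp Hpf; case: (pp) => _ _ _ _ gts.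
pose Y l t : R := if l == i then (g t)^-1 else if l == j then e * (g t)^-1 else - e * g1 t / g t.
have U3 : [/\ j == i = false, k == i = false & k == j = false].
  by move: U; rewrite uniq3E (eq_sym j i) (eq_sym k i) (eq_sym k j) => /and3P[/negPf -> /negPf -> /negPf ->].
have [Yi Yj Yk] : [/\ forall t, Y i t = (g t)^-1, forall t, Y j t = e * (g t)^-1 &
    forall t, Y k t = - e * g1 t / g t].
  by case: U3 => a1 a2 a3; split => t; rewrite /Y ?eqxx ?a1 ?a2 ?a3.
have oH := half_line_open_interval ts d1.
have Ypf : pole_form Y (half_line d ts) i j k e K g g1 ts.
  split => // t Ht; split; rewrite ?Yi ?Yj ?Yk //.
  rewrite -normr_gt0; apply: lt_le_trans (gts t); rewrite normr_gt0.
  by apply: contraTneq Ht => ->; rewrite /half_line /= mulr0 ltxx.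
have Ye : euler_curve Y (half_line d ts) by case: oH => ? _ _; exact: (pole_curve_euler U Ypf).
case: muP => mu0 muE _.
apply: (zmax (fun t => \row_l ((mu l)^-1 * Y l t))) => //.
- split => // t Ht; apply: is_derive_mx => i0 l; rewrite ord1.
  have [m [n Ul]] := uniq3_ex l.
  rewrite (_ : (fun s => _) = fun s => (mu l)^-1 * Y l s); last by apply/funext => s; rewrite mxE.
  apply: (is_derive_eq (is_derive_funZ (mu l)^-1 (Ye l m n Ul t Ht))).
  apply: (mulfI (mu0 l)); rewrite (muE _ _ _ _ Ul) !mxE.
  by field; rewrite !mu0.
- move=> t It; apply/rowP => l; rewrite mxE; apply: (mulfI (mu0 l)).
  rewrite mulrA mulfV // mul1r.
  by have [_ h1 h2 h3] := Hpf t It; case: (uniq3_cases l U) => ->; rewrite ?Yi ?Yj ?Yk.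
Qed.

End Dynamics.

(** * Behaviour of tied trajectories at the pole and at infinity *)

Section Poles.
Context {R : realType} {a b c : R} {mu : 'I_3 -> R}.
Hypothesis muP : is_scaling a b c mu.
Local Notation E := (lax_field a b c).
Local Notation scaled z := (fun l t => mu l * z t 0 l).
Implicit Types (z w : R -> 'rV[R]_3) (I J : set R) (i j k l : 'I_3).

(** [g] and [g1] are differentiable on all of [R], hence bounded on a segment containing [J], even
    if the pole is an end of [J]. *)
Lemma pole_bounded z J i j k e K g g1 ts :
  pole_form (scaled z) J i j k e K g g1 ts -> has_ubound J -> has_lbound J ->
  exists M : R, forall t, J t -> `|g t| <= M /\ `|g1 t| <= M.
Proof.
move=> [_ [dg dg1 _ _ _] _] [B JB] [A JA].
have [[t0 Jt0]|/forallNP J0] := pselect (exists t, J t); last first.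
  by exists 0 => t Jt; have := J0 t Jt.
have AB : A <= B by apply: le_trans (JA _ Jt0) (JB _ Jt0).
have [M1 H1] := derivable_bounded AB (fun u _ => dg u).
have [M2 H2] := derivable_bounded AB (fun u _ => dg1 u).
exists (Num.max M1 M2) => t Jt; have tAB : A <= t <= B by rewrite JA // JB.
by rewrite !le_max H1 // H2 // orbT.
Qed.

(** For [K = 0] the function [g1] is constant with square [1], so every rescaled coordinate is a
    constant of square [1] times [1/g]: the motion is radial, on a line through a point [p]. *)
Lemma pole_reduces z I i j k e g g1 ts : I !=set0 -> (forall t, I t -> z t != 0) ->
  uniq [:: i; j; k] -> pole_form (scaled z) I i j k e 0 g g1 ts ->
  exists2 p, p_points a b c p & reduces_to (@rp_class R @` (z @` I)) p.
Proof.
move=> [t0 It0] z0 U [e1 [dg dg1 gg _ _] Hp]; case: (muP) => mu0 _ pP.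
have g1c t : g1 t = g1 t0.
  apply: (@derive0_const _ g1 setT) => // u _.
  by apply: (is_derive_eq (dg1 u)); rewrite mul0r.
have sq t l : I t -> (mu l * z t 0 l) ^+ 2 = (g t)^-1 ^+ 2.
  move=> It; have [h0 h1 h2 h3] := Hp t It.
  case: (uniq3_cases l U) => ->; rewrite ?h1 ?h2 ?h3 // exprMn ?e1 ?mul1r //.
  by rewrite exprMn sqrrN e1 mul1r gg mul0r addr0 mul1r.
exists (rp_class (z t0)); first by apply/pP; [exact: z0|move=> l l'; rewrite !sq].
have zE t : I t -> rp_class (z t) = rp_class (z t0).
  move=> It; have [h0 h1 h2 h3] := Hp t It; have [h0' h1' h2' h3'] := Hp t0 It0.
  rewrite (_ : z t = (g t0 / g t) *: z t0).
    by rewrite rp_classZ ?z0 // mulf_neq0 // invr_eq0.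
  apply/rowP => l; rewrite mxE; apply: (mulfI (mu0 l)); rewrite mulrCA.
  case: (uniq3_cases l U) => ->; rewrite ?h1 ?h2 ?h3 ?h1' ?h2' ?h3' ?(g1c t);
    by field; rewrite h0 h0'.
rewrite /reduces_to; apply/seteqP; split => [p [_ [t It <-] <-]|p ->] /=; first exact: zE.
by exists (z t0) => //; exists t0.
Qed.

(** In rescaled coordinates [g z] is [(1, e, - e g1)], which tends at the pole to a vector with
    equal squares since [g1 ts ^+ 2 = 1]. Likewise [(g / g1) z] is [(1/g1, e/g1, - e)], which tends
    to the axis [k] at infinity because [K > 0] makes [|g1|] grow. *)
Lemma pole_joins z d ts i j k e K g g1 : d ^+ 2 = 1 -> 0 < K ->
  (forall t, half_line d ts t -> z t != 0) ->
  uniq [:: i; j; k] -> pole_form (scaled z) (half_line d ts) i j k e K g g1 ts ->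
  exists p r, [/\ p_points a b c p, q_points r &
    joins (fun t => rp_class (z t)) (half_line d ts) p r].
Proof.
move=> d1 K0 z0 U [e1 [dg dg1 gg g0 gts] Hp]; case: (muP) => mu0 _ pP.
set H := half_line d ts in Hp *.
have [oH itvH Hn0] := half_line_open_interval ts d1.
have UF := upper_end_filter Hn0; have LF := lower_end_filter Hn0.
have [near [far [ends Hnear Hfar]]] := half_line_ends ts d1.
have nF : Filter near by case: ends => -[-> _].
have fF : Filter far by case: ends => -[_ ->].
have [Uj Uk Ukj] : [/\ j == i = false, k == i = false & k == j = false].
  by move: U; rewrite uniq3E (eq_sym j i) (eq_sym k i) (eq_sym k j) => /and3P[/negPf -> /negPf -> /negPf ->].
have g10 t : g1 t != 0.
  rewrite -sqrf_eq0 gg gt_eqF // ltr_wpDr // mulr_ge0 ?sqr_ge0 //; exact: ltW.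
pose vp : 'rV[R]_3 := \row_l ((mu l)^-1 * (if l == i then 1 else if l == j then e else - e * g1 ts)).
pose vr : 'rV[R]_3 := ((mu k)^-1 * - e) *: delta_mx 0 k.
have e0 : e != 0 by rewrite -sqrf_eq0 e1 oner_eq0.
have vp0 : vp != 0.
  apply/eqP => /rowP /(_ i); rewrite !mxE eqxx mulr1 => /eqP.
  by rewrite invr_eq0 (negPf (mu0 i)).
have kr : (mu k)^-1 * - e != 0 by rewrite mulf_neq0 ?invr_eq0 ?oppr_eq0.
have vr0 : vr != 0 by rewrite scaler_eq0 negb_or kr delta_neq0.
exists (rp_class vp), (rp_class vr); split.
- apply/pP => //; suff sq l : (mu l * vp 0 l) ^+ 2 = 1 by move=> l l'; rewrite !sq.
  rewrite mxE mulrA mulfV // mul1r; case: ifP => _; first by rewrite expr1n.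
  by case: ifP => _ //; rewrite exprMn sqrrN e1 mul1r gg g0 expr0n mulr0 addr0.
- by rewrite rp_classZ ?delta_neq0 //; by apply/q_pointsP; exists k.
split.
(* If the projected curve were a point, the ratio of the rescaled coordinates [k] and [i], which is
   [- e g1], would agree at two times. By the mean value theorem [K g] would then vanish in
   between. *)
- move=> r red.
  have [Ht1 Ht2] : H (ts + d) /\ H (ts + 2 * d).
    rewrite /H /half_line /= (_ : ts + d - ts = d); last ring.
    rewrite (_ : ts + 2 * d - ts = 2 * d); last ring.
    by rewrite mulrCA -expr2 d1; split; lra.
  have zr t : H t -> rp_class (z t) = r.
    by move=> Ht; have : [set r] (rp_class (z t)) by rewrite -red; exists t.
  have [x x0 zz] := rp_class_eqP (z0 _ Ht1) (z0 _ Ht2) (etrans (zr _ Ht1) (esym (zr _ Ht2))).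
  have [a0 a1 a2 a3] := Hp _ Ht1; have [b0 b1 b2 b3] := Hp _ Ht2.
  move: a1 a3; rewrite zz !mxE (mulrCA _ x) (mulrCA _ x) b1 b3 => a1 a3.
  have gE : g1 (ts + d) = g1 (ts + 2 * d).
    apply: (mulfI e0); apply: (@mulIf _ (- (g (ts + d))^-1)).
      by rewrite oppr_eq0 invr_eq0.
    transitivity (- e * g1 (ts + d) / g (ts + d)); first by ring.
    by rewrite -a3 -a1; ring.
  have [u Hu] := mvt_on itvH (fun u _ => dg1 u) Ht1 Ht2.
  rewrite gE subrr => /esym /eqP; rewrite !mulf_eq0 (gt_eqF K0) /=.
  have [gu _ _ _] := Hp u Hu; rewrite (negPf gu) /= => /eqP h.
  have : d = 0 by rewrite -h; ring.
  by move=> dd; move: d1; rewrite dd expr0n /= => /eqP; rewrite eq_sym oner_eq0.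
- have cvg_near : rp_class (z t) @[t --> near] --> rp_class vp.
    apply: (@rp_cvg_scaled _ near z g vp) => //.
      apply: filterS (Hnear 1 ltr01) => t [Ht _]; split; last exact: z0.
      by have [] := Hp t Ht.
    move=> l.
    pose cl t : R := (mu l)^-1 * (if l == i then 1 else if l == j then e else - e * g1 t).
    have cc : {for ts, continuous cl}.
      apply: (@continuousM _ _ (fun=> (mu l)^-1)); first exact: cst_continuous.
      case: (l == i); first exact: cst_continuous.
      case: (l == j); first exact: cst_continuous.
      apply: (@continuousM _ _ (fun=> - e)); first exact: cst_continuous.
      apply: differentiable_continuous; apply/derivable1_diffP.
      by have := dg1 ts => ?; exact: ex_derive.
    rewrite mxE -/(cl ts) => V /cc /nbhs_ballP[/= x x0 xV].
    change (near [set t | V (g t * z t 0 l)]).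
    apply: filterS (Hnear x x0) => t [Ht tx] /=.
    have [h0 h1 h2 h3] := Hp t Ht.
    rewrite (_ : g t * z t 0 l = cl t); first by apply: xV; rewrite /ball /= distrC.
    apply: (mulfI (mu0 l)); rewrite mulrCA /cl [RHS]mulrA mulfV // mul1r.
    case: (uniq3_cases l U) => ->; rewrite ?eqxx ?Uj ?Uk ?Ukj ?h1 ?h2 ?h3; by field.
  have cvg_far : rp_class (z t) @[t --> far] --> rp_class vr.
    apply: (@rp_cvg_scaled _ far z (fun t => g t / g1 t) vr) => //.
      apply: filterS (Hfar 1) => t [Ht _]; split; last exact: z0.
      by have [? _ _ _] := Hp t Ht; rewrite mulf_neq0 ?invr_eq0.
    have inv0 : (g1 t)^-1 @[t --> far] --> (0 : R).
      apply/cvgrPdist_lt => x x0.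
      (* [g1^2 = 1 + K g^2 > K (t - ts)^2], so [1/|g1| < x] as soon as [t] is farther than this [N]
         from the pole. *)
      pose N := (x * Num.sqrt K)^-1.
      have sK : 0 < Num.sqrt K by rewrite sqrtr_gt0.
      have N0 : 0 < N by rewrite invr_gt0 mulr_gt0.
      apply: filterS (Hfar N) => t [Ht tN]; rewrite sub0r normrN normfV.
      have g1N : 0 < `|g1 t| by rewrite normr_gt0.
      rewrite invf_plt ?posrE // -ltr_sqr ?nnegrE ?invr_ge0 ?(ltW x0) //.
      rewrite real_normK ?num_real // gg.
      have NK : x^-1 ^+ 2 = K * N ^+ 2.
        rewrite /N !exprVn exprMn sqr_sqrtr ?(ltW K0) //; field.
        by rewrite !gt_eqF.
      rewrite NK ltr_pwDl // ler_wpM2l ?(ltW K0) // -[leRHS]real_normK ?num_real //.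
      rewrite ler_sqr ?nnegrE ?(ltW N0) //.
      by apply: le_trans (ltW tN) _; exact: gts.
    move=> l.
    have cst_cvg (x : R) : x * (g1 t)^-1 @[t --> far] --> (0 : R).
      by rewrite -(mulr0 x); apply: cvgM => //; exact: cvg_cst.
    (* The formulas hold only on [H], which belongs to the filter [far], so limits transfer between
       functions agreeing on [H]. *)
    have ext (f h : R -> R) (y : R) : (forall t, H t -> f t = h t) ->
        f t @[t --> far] --> y -> h t @[t --> far] --> y.
      move=> fh fy V /fy fV; change (far [set t | V (h t)]).
      have {}fV : far [set t | V (f t)] := fV.
      by move: (Hfar 0) fV; apply: filterS2 => t [Ht _] /=; rewrite fh.
    rewrite /vr !mxE eqxx /=; case: (uniq3_cases l U) => ->.
    + rewrite eq_sym Uk mulr0; apply: ext (cst_cvg (mu i)^-1) => t Ht.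
      have [h0 h1 h2 h3] := Hp t Ht.
      by apply: (mulfI (mu0 i)); rewrite mulrA mulfV // mulrCA h1; field; rewrite h0 g10.
    + rewrite eq_sym Ukj mulr0; apply: ext (cst_cvg ((mu j)^-1 * e)) => t Ht.
      have [h0 h1 h2 h3] := Hp t Ht.
      apply: (mulfI (mu0 j)); rewrite mulrCA [RHS]mulrCA h2.
      by field; rewrite h0 g10 mu0.
    + rewrite eqxx mulr1; apply: ext (cvg_cst ((mu k)^-1 * - e)) => t Ht.
      have [h0 h1 h2 h3] := Hp t Ht.
      apply: (mulfI (mu0 k)); rewrite [RHS]mulrCA h3.
      by field; rewrite h0 g10 mu0.
  by case: ends => -[nE fE]; [left|right]; rewrite -nE -fE.
Qed.

(** A cone around the axis [k] is a neighbourhood of the limit point, so the curve enters it at the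
    end, lower or upper, that converges there. *)
Lemma joins_approaches z I p k (x : R) : open_interval I ->
  (forall t, I t -> z t != 0) ->
  joins (fun t => rp_class (z t)) I p (rp_class (delta_mx 0 k)) -> 0 < x ->
  exists2 t, I t & forall l, l != k ->
    (mu l * z t 0 l) ^+ 2 < x * (mu k * z t 0 k) ^+ 2.
Proof.
move=> [oI _ In0] z0 [_ J] x0; case: (muP) => mu0 _ _.
have UF := upper_end_filter In0; have LF := lower_end_filter In0.
(* The aperture in the original coordinates, chosen so that [mu_l^2 dx_l = x mu_k^2]. *)
pose dx l := x * (mu k / mu l) ^+ 2.
have dx0 l : 0 < dx l.
  by rewrite mulr_gt0 // exprn_even_gt0 //= mulf_neq0 // invr_eq0.
have main (F : set_system R) : Filter F -> F I ->
    rp_class (z t) @[t --> F] --> rp_class (delta_mx 0 k) ->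
    F [set t | forall l, l != k -> (mu l * z t 0 l) ^+ 2 < x * (mu k * z t 0 k) ^+ 2].
  move=> FF FI cv.
  have H l : l != k -> F [set t | (z t 0 l) ^+ 2 < dx l * (z t 0 k) ^+ 2].
    move=> lk; apply: (@rp_cvg_open _ _ F z (delta_mx 0 k)
      [set u : 'rV[R]_3 | (u 0 l) ^+ 2 < dx l * (u 0 k) ^+ 2]) => //.
    - exact: open_dominated.
    - move=> s u s0 /= ul; rewrite !mxE !exprMn (mulrCA (dx l)) ltr_pM2l //.
      by rewrite exprn_even_gt0.
    - exact: delta_neq0.
    - by rewrite /= !mxE !eqxx (negPf lk) expr0n /= expr1n mulr1.
    - by apply: filterS FI => t; exact: z0.
  have {}H : F [set t | forall l : 'I_3, l != k -> (z t 0 l) ^+ 2 < dx l * (z t 0 k) ^+ 2].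
    apply: filter_forall => l; have [->|lk] := eqVneq l k.
      by apply: filterS FI => t _; rewrite ?eqxx.
    by apply: filterS (H l lk) => t.
  apply: filterS H => t Ht l lk; have := Ht l lk.
  rewrite -(@ltr_pM2l _ (mu l ^+ 2)) ?exprn_even_gt0 ?mu0 // -exprMn => h.
  apply: lt_le_trans h _; rewrite le_eqVlt; apply/orP; left; apply/eqP.
  by rewrite /dx; field; exact: mu0.
have UI : upper_end I I by case: In0 => s Is; exists s => // t [].
have LI : lower_end I I by case: In0 => s Is; exists s => // t [].
case: J => -[cl cu].
- exact: (upper_end_nonempty oI (main _ UF UI cu)).
- exact: (lower_end_nonempty oI (main _ LF LI cl)).
Qed.

End Poles.

(** * Comparison of two integral curves with the same image *)

Section SameTrajectory.
Context {R : realType} {a b c : R} {mu : 'I_3 -> R}.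
Hypothesis muP : is_scaling a b c mu.
Local Notation E := (lax_field a b c).
Local Notation scaled z := (fun l t => mu l * z t 0 l).
Variables (z w : R -> 'rV[R]_3) (I J : set R).
Hypothesis zmax : maximal_integral_curve E z I.
Hypothesis wJ : integral_curve E w J.
Hypothesis wz : w @` J = z @` I.
Hypothesis L0 : ~ (z @` I) 0.
Hypothesis noaxis : ~ exists k : 'I_3, forall v, (z @` I) v -> forall l, l != k -> v 0 l = 0.

Let z_neq0 t : I t -> z t != 0.
Proof. by move=> It; apply/eqP => zt; apply: L0; exists t. Qed.

Let onJ t : J t -> exists2 s, I s & z s = w t.
Proof. by move=> Jt; have : (w @` J) (w t) by [exists t]; rewrite wz => -[s Is <-]; exists s. Qed.

Let onI t : I t -> exists2 s, J s & w s = z t.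
Proof. by move=> It; have : (z @` I) (z t) by [exists t]; rewrite -wz => -[s Js <-]; exists s. Qed.

(** The class found for [w] is a condition on the points of the common image, hence holds for [z].
    Being maximal, [z] then fills a half-line, and the sign of [K] separates the two conclusions. *)
Lemma unbounded_joins : ~ has_ubound J \/ ~ has_lbound J ->
  (exists p r, [/\ p_points a b c p, q_points r &
     joins (fun t => rp_class (z t)) I p r]) \/
  (exists2 p, p_points a b c p & reduces_to (@rp_class R @` (z @` I)) p).
Proof.
move=> ub.
have [|[k H]|[i [j [k [K [U K0 H]]]]]] := unbounded_classify muP wJ _ ub.
- by move=> t /onJ[s /z_neq0 + <-].
- by case: noaxis; exists k => v; rewrite -wz => -[t Jt <-]; exact: H.
have zH t : I t -> tied_min K i j k (fun l => mu l * z t 0 l).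
  by move=> /onI[s Js <-]; exact: H.
have [e [g [g1 [ts [d [d1 Id pf]]]]]] := pole_maximal muP zmax U K0 zH.
move: K0; rewrite le_eqVlt => /orP[/eqP K0|K0]; last first.
  left; move: z_neq0 pf; rewrite Id => z0 pf.
  exact: (pole_joins muP d1 K0 z0 U pf).
right; rewrite -K0 in pf; apply: (pole_reduces muP _ _ U pf); last exact: z_neq0.
by case: zmax => -[[]].
Qed.

(** By contradiction, with [J] bounded on both sides. A strict minimum keeps the image away from the
    axes and from equal squares; in the tied class, bounds on the pole form of [w] contradict the
    behaviour of [z] on its half-line. *)
Lemma joins_unbounded :
  (exists p r, [/\ p_points a b c p, q_points r &
     joins (fun t => rp_class (z t)) I p r]) \/
  (exists2 p, p_points a b c p & reduces_to (@rp_class R @` (z @` I)) p) ->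
  ~ has_ubound J \/ ~ has_lbound J.
Proof.
case: (muP) => mu0 _ pP; case: (zmax) => zI _; case: (zI) => oI _.
move=> H; apply: contrapT => /not_orP[/contrapT Ju /contrapT Jl].
(* Both alternatives become conditions on points of the image: entering arbitrarily narrow cones
   around one axis, or having equal rescaled squares. *)
have {}H : (exists k, forall x : R, 0 < x -> exists2 t, I t & forall l, l != k ->
      (mu l * z t 0 l) ^+ 2 < x * (mu k * z t 0 k) ^+ 2) \/
    (forall t, I t -> forall l l', (mu l * z t 0 l) ^+ 2 = (mu l' * z t 0 l') ^+ 2).
  case: H => [[p [r [_ /q_pointsP[k ->] jo]]]|[p pp red]].
    left; exists k => x x0; exact: (joins_approaches muP oI z_neq0 jo x0).
  right => t It; apply/pP; first exact: z_neq0.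
  have : [set p] (rp_class (z t)) by rewrite -red; exists (z t) => //; exists t.
  by move=> ->.
have [i [j [k [U cls]]]] := lax_classify muP zI z_neq0.
move: (U); rewrite uniq3E => /and3P[ij ik jk].
have [ji ki kj] : [/\ j != i, k != i & k != j] by rewrite ![k == _]eq_sym [j == i]eq_sym.
have [t0 It0] : I !=set0 by case: oI.
case: cls => [ax|[x [y [x0 y0 sm]]]|[K K0 tm]].
- case: noaxis; exists k => v [t It <-]; exact: (on_axis_coord muP U (ax t It)).
- case: H => [[k' H]|H]; last first.
    have [e1 e2] := sm t0 It0.
    by move: e1; rewrite (H t0 It0 j i); lra.
  case: (uniq3_cases k' U) => kE; rewrite kE in H.
  + have [t It Ht] := H 1 ltr01; have [e1 e2] := sm t It.
    by have := Ht j ji; rewrite e1 mul1r; lra.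
  (* With [Y_l] the rescaled coordinates and [m] this minimum, the cone gives
     [Y_k^2 < m Y_j^2 = m (Y_i^2 + x)], and the choice of [m] bounds the right side by
     [Y_i^2 + y = Y_k^2]. The next case is symmetric. *)
  + have q0 : 0 < Num.min 1 (y / x) by rewrite lt_min ltr01 divr_gt0.
    have [t It Ht] := H _ q0; have [e1 e2] := sm t It.
    have := Ht k kj; rewrite e1 e2 mulrDr => h.
    have h1 : Num.min 1 (y / x) * (mu i * z t 0 i) ^+ 2 <= (mu i * z t 0 i) ^+ 2.
      by rewrite ler_piMl ?sqr_ge0 // ge_min lexx.
    have h2 : Num.min 1 (y / x) * x <= y.
      by rewrite -ler_pdivlMr // ge_min lexx orbT.
    by move: h h1 h2; lra.
  + have q0 : 0 < Num.min 1 (x / y) by rewrite lt_min ltr01 divr_gt0.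
    have [t It Ht] := H _ q0; have [e1 e2] := sm t It.
    have := Ht j jk; rewrite e1 e2 mulrDr => h.
    have h1 : Num.min 1 (x / y) * (mu i * z t 0 i) ^+ 2 <= (mu i * z t 0 i) ^+ 2.
      by rewrite ler_piMl ?sqr_ge0 // ge_min lexx.
    have h2 : Num.min 1 (x / y) * y <= x.
      by rewrite -ler_pdivlMr // ge_min lexx orbT.
    by move: h h1 h2; lra.
- have wtm t : J t -> tied_min K i j k (fun l => mu l * w t 0 l).
    by move=> /onJ[s Is <-]; exact: tm.
  case: (wJ) => -[_ itvJ Jn0] _.
  have [e [g [g1 [ts pf]]]] := tied_min_pole K0 itvJ Jn0 (lax_euler muP wJ) U wtm.
  have [M HM] := pole_bounded pf Ju Jl; case: (pf) => e1 [_ _ gg _ _] Hp.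
  have wsq t : J t -> [/\ g t != 0, (mu i * w t 0 i) ^+ 2 = (g t ^+ 2)^-1,
      (mu k * w t 0 k) ^+ 2 = g1 t ^+ 2 / g t ^+ 2, g t ^+ 2 <= M ^+ 2 & g1 t ^+ 2 <= M ^+ 2].
    move=> Jt; have [h0 h1 h2 h3] := Hp t Jt; have [m1 m2] := HM t Jt.
    have M0 : 0 <= M by apply: le_trans m1.
    split => //; rewrite ?h1 ?h3.
    - by rewrite exprVn.
    - by rewrite !exprMn sqrrN e1 mul1r exprVn.
    - by rewrite -(real_normK (num_real (g t))) ler_sqr ?nnegrE.
    - by rewrite -(real_normK (num_real (g1 t))) ler_sqr ?nnegrE.
  case: H => [[k' H]|H].
    case: (uniq3_cases k' U) => kE; rewrite kE in H.
    + have [t It Ht] := H 1 ltr01; have [_ _ e2] := tm t It.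
      by have := Ht k ki; rewrite e2 mul1r; lra.
    + have [t It Ht] := H 1 ltr01; have [_ e2 e3] := tm t It.
      by have := Ht k kj; rewrite e2 e3 mul1r; lra.
    (* The ratio of the squares with indices [k] and [i] is [g1^2 <= M^2], so the image misses the
       cone of aperture [1/(M^2 + 1)]. *)
    + have M0 : 0 < M ^+ 2 + 1 by rewrite ltr_wpDl ?sqr_ge0.
      have [|t It Ht] := H (M ^+ 2 + 1)^-1; first by rewrite invr_gt0.
      have [s Js sE] := onI It; have := Ht i ik; rewrite -sE.
      have [h0 -> -> _ m] := wsq s Js.
      have g0 : 0 < g s ^+ 2 by rewrite exprn_even_gt0.
      rewrite mulrA -[X in X < _]mul1r ltr_pM2r ?invr_gt0 //.
      by rewrite mulrC ltr_pdivlMr // mul1r; lra.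
  have KE : K = 0.
    by have [_ _] := tm t0 It0; rewrite (H t0 It0 k i); lra.
  have [e' [g' [g1' [ts' [d [d1 Id pf']]]]]] := pole_maximal muP zmax U K0 tm.
  case: pf' => _ [_ _ _ _ gts] Hp'.
  (* A time of the half-line at distance [|M| + 1] from the pole of [z], where [|g'|] is at least
     that distance. The same point on [w] gives [g' t ^+ 2 = g s ^+ 2 <= M^2]. *)
  pose t := ts' + d * (`|M| + 1).
  have tsE : t - ts' = d * (`|M| + 1) by rewrite /t; ring.
  have nM : 0 <= `|M| by [].
  have It : I t by rewrite Id /half_line /= tsE mulrA -expr2 d1 mul1r; lra.
  have [s Js sE] := onI It.
  have [h0 h1 _ _] := Hp' t It.
  have [f0 f1 _ f2 _] := wsq s Js; move: f1; rewrite sE h1 exprVn => /invr_inj gE.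
  have := gts t; rewrite tsE normrM.
  have -> : `|d| = 1 by case: (sqr_eq1 d1) => ->; rewrite ?normrN normr1.
  have nM1 : 0 <= `|M| + 1 by lra.
  rewrite mul1r (ger0_norm nM1) -ler_sqr ?nnegrE //.
  rewrite real_normK ?num_real // gE => hh.
  have : (`|M| + 1) ^+ 2 <= `|M| ^+ 2 by rewrite (real_normK (num_real M)) (le_trans hh).
  by nra.
Qed.

End SameTrajectory.

(** * Geodesics of SL(2,R) *)

Section SquareTwo.
Context {R : comNzRingType}.
Implicit Types (A X : 'M[R]_2).

Lemma mulmx2E A X i j : (A *m X) i j = A i 0 * X 0 j + A i 1 * X 1 j.
Proof. by rewrite mxE !big_ord_recl big_ord0 addr0; congr (_ + A i _ * X _ j); apply: val_inj. Qed.

Lemma mxtrace2E A : \tr A = A 0 0 + A 1 1.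
Proof. by rewrite /mxtrace !big_ord_recl big_ord0 addr0; congr (_ + A _ _); apply: val_inj. Qed.

Lemma det2E A : \det A = A 0 0 * A 1 1 - A 0 1 * A 1 0.
Proof.
rewrite (expand_det_row _ 0) !big_ord_recl big_ord0 addr0 /cofactor !det_mx11 !mxE /=.
rewrite expr0 mul1r expr1 mulN1r mulrN.
by congr (A _ _ * A _ _ - A _ _ * A _ _); apply: val_inj.
Qed.

Lemma ord2P (P : 'I_2 -> Prop) : P 0 -> P 1 -> forall i, P i.
Proof.
by move=> P0 P1 [[|[|//]] i2]; [move: P0|move: P1]; congr P; apply: val_inj.
Qed.

(** Cayley-Hamilton with zero trace. It makes the exponential of [t X] a combination of the identity
    and [X]. *)
Lemma traceless_sqr X : \tr X = 0 -> X *m X = (- \det X)%:M.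
Proof.
rewrite mxtrace2E det2E => /eqP; rewrite addr_eq0 => /eqP x0.
by apply/matrixP; apply: ord2P; apply: ord2P; rewrite mulmx2E !mxE /= x0; ring.
Qed.

Lemma det_scalar_add X (s t : R) : \tr X = 0 ->
  \det (s%:M + t *: X) = s ^+ 2 + t ^+ 2 * \det X.
Proof.
rewrite mxtrace2E !det2E !mxE /= => /eqP; rewrite addr_eq0 => /eqP ->.
ring.
Qed.

End SquareTwo.

(* [sesquilinear] also exports a lemma of this name. *)
Local Notation formB := Defs.formB.

(** * Bilinearity and symmetry of the form and of the bracket *)

Section Sl2.
Context {R : realType}.
Implicit Types (x y u : sl2 R).

Lemma formBDl x y u : formB (x + y) u = formB x u + formB y u.
Proof. by rewrite /formB linearD /= mulmxDl mxtraceD mulrDr. Qed.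

Lemma formBZl (k : R) x u : formB (k *: x) u = k * formB x u.
Proof. by rewrite /formB linearZ /= -scalemxAl mxtraceZ mulrCA. Qed.

Lemma formBNl x u : formB (- x) u = - formB x u.
Proof. by rewrite -scaleN1r formBZl mulN1r. Qed.

Lemma formBC x y : formB x y = formB y x.
Proof. by rewrite /formB mxtrace_mulC. Qed.

Lemma bracketDl x y u : sl2_bracket (x + y) u = sl2_bracket x u + sl2_bracket y u.
Proof.
apply: val_inj; rewrite [in RHS]linearD /= !sl2_bracketE linearD /= mulmxDl mulmxDr.
by rewrite opprD addrACA.
Qed.

Lemma bracketZl (k : R) x u : sl2_bracket (k *: x) u = k *: sl2_bracket x u.
Proof.
apply: val_inj; rewrite [in RHS]linearZ /= !sl2_bracketE linearZ /=.
by rewrite -scalemxAl -scalemxAr scalerBr.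
Qed.

Lemma bracketC x y : sl2_bracket x y = - sl2_bracket y x.
Proof. by apply: val_inj; rewrite linearN /= !sl2_bracketE opprB. Qed.

Lemma bracketxx x : sl2_bracket x x = 0.
Proof. by rewrite /sl2_bracket subrr linear0. Qed.

Lemma sl2_traceless x : \tr (vsval x) = 0.
Proof. by apply/eqP; rewrite -mem_sl2V; exact: subvsP. Qed.

End Sl2.

(** * The Lax equation of a geodesic, and geodesics with constant velocity *)

Section AdaptedBasis.
Context {R : realType} {q : {symmetric (sl2 R)}} {Phi : 'End(sl2 R)}
  {v1 v2 v3 : sl2 R} {nu1 nu2 nu3 : R}.
Hypothesis qPhi : associated_isomorphism q Phi.
Hypothesis adb : adapted_basis Phi v1 v2 v3 nu1 nu2 nu3.
Local Notation lax := (lax_curve Phi v1 v2 v3).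
Local Notation E := (lax_field (nu2 - nu3) (nu3 - nu1) (nu2 - nu1)).
Implicit Types (x y u : sl2 R) (gamma : R -> 'M[R]_2) (J : set R) (t : R).

Let B : 3.-tuple (sl2 R) := [tuple v1; v2; v3].

(** The basis is orthogonal with squares [1, 1, -1], so pairing with a basis vector recovers the
    coordinate, with a sign for the third. *)
Lemma adapted_coord u : u = formB u v1 *: v1 + formB u v2 *: v2 + (- formB u v3) *: v3 /\
  [/\ coord B (inord 0) u = formB u v1, coord B (inord 1) u = formB u v2 &
      coord B (inord 2) u = - formB u v3].
Proof.
case: adb => bas _ [n1 n2 n3] [p1 p2 p3] _.
have uE : u = \sum_i coord B i u *: B`_i.
  by rewrite -(coord_basis (U := fullv) (X := B)) ?memvf.
move: uE; rewrite !big_ord_recl big_ord0 addr0 /=.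
have -> : ord0 = inord 0 :> 'I_3 by apply: val_inj; rewrite /= inordK.
have -> : lift (inord 0) ord0 = inord 1 :> 'I_3 by apply: val_inj; rewrite /= !inordK.
have -> : lift (inord 0) (lift ord0 ord0) = inord 2 :> 'I_3 by apply: val_inj; rewrite /= !inordK.
move: (coord B (inord 0) u) (coord B (inord 1) u) (coord B (inord 2) u) => c0 c1 c2 uE.
have [f1 f2 f3] : [/\ formB u v1 = c0, formB u v2 = c1 & formB u v3 = - c2].
  rewrite uE !formBDl !formBZl n1 n2 n3 p1 p2 p3 (formBC v2 v1) (formBC v3 v1) (formBC v3 v2) p1 p2 p3.
  by split; ring.
by rewrite f1 f2 f3 opprK; split => //; rewrite uE addrA.
Qed.

Lemma adapted_ext x y : formB x v1 = formB y v1 -> formB x v2 = formB y v2 ->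
  formB x v3 = formB y v3 -> x = y.
Proof.
move=> e1 e2 e3; have [xE _] := adapted_coord x; have [yE _] := adapted_coord y.
by rewrite xE yE e1 e2 e3.
Qed.

Lemma lax_coords gamma t : [/\ lax gamma t 0 (inord 0) = formB (Phi (velocity gamma t)) v1,
  lax gamma t 0 (inord 1) = formB (Phi (velocity gamma t)) v2 &
  lax gamma t 0 (inord 2) = - formB (Phi (velocity gamma t)) v3].
Proof. by have [_] := adapted_coord (Phi (velocity gamma t)); rewrite /lax_curve !mxE. Qed.

Lemma PhiK x : (Phi^-1)%VF (Phi x) = x.
Proof. by case: qPhi => /eqP k0 _ _; rewrite lker0_lfunK. Qed.

(** Compatibility gives [q (nabla x x) y = - q x (nabla x y)], the torsion identity replaces
    [nabla x y] by [nabla y x + [x, y]], and [q x (nabla y x)] vanishes by compatibility again. *)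
Lemma levi_civita_square nabla x y : levi_civita q nabla ->
  formB (Phi (nabla x x)) y = - formB (Phi x) (sl2_bracket x y).
Proof.
case: qPhi => _ sa qE [tors metric].
have qD u a b : q u (a + b) = q u a + q u b by rewrite linearDr.
have qC u a : q u a = q a u by rewrite !qE sa formBC.
rewrite -!qE; apply/eqP; rewrite -addr_eq0; apply/eqP.
have := metric x x y; have := metric y x x.
have -> : nabla x y = nabla y x + sl2_bracket x y by rewrite -tors addrC subrK.
rewrite qD (qC (nabla y x) x) => h1 h2.
have h3 : q x (nabla y x) = 0 by lra.
by move: h2; rewrite h3 add0r.
Qed.

Lemma is_derive_mxtrace (M : R -> 'M[R]_2) (A D : 'M[R]_2) t :
  is_derive t 1 M D -> is_derive t 1 (fun s => \tr (M s *m A)) (\tr (D *m A)).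
Proof.
move=> dM; rewrite mxtrace2E !mulmx2E.
rewrite (_ : (fun s => _) = fun s => (A 0 0 * M s 0 0 + A 1 0 * M s 0 1) +
    (A 0 1 * M s 1 0 + A 1 1 * M s 1 1)); last first.
  by apply/funext => s; rewrite mxtrace2E !mulmx2E; ring.
have d i j := is_derive_coord i j dM.
apply: (is_derive_eq (is_derive_funD
  (is_derive_funD (is_derive_funZ _ (d 0 0)) (is_derive_funZ _ (d 0 1)))
  (is_derive_funD (is_derive_funZ _ (d 1 0)) (is_derive_funZ _ (d 1 1))))).
ring.
Qed.

(** The geodesic equation [x' = - nabla x x] tested against a fixed [y]. By invariance of the trace
    form the derivative is [formB [z, x] y] with [z = Phi x]: the Lax equation in weak form. *)
Lemma geodesic_formB gamma J t y : geodesic q gamma J -> J t ->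
  is_derive t 1 (fun s => formB (Phi (velocity gamma s)) y)
    (formB (Phi (velocity gamma t)) (sl2_bracket (velocity gamma t) y)).
Proof.
case: (qPhi) => _ sa qE [_ [nabla lc geo]] Jt; have [_ _ dv] := geo t Jt.
have := is_derive_funZ 2 (is_derive_mxtrace (vsval (Phi y)) dv).
rewrite (_ : (fun s => _) = (fun s => formB (Phi (velocity gamma s)) y)); last first.
  by apply/funext => s; rewrite sa.
move=> h; apply: (is_derive_eq h).
rewrite mulNmx linearN /= mulrN -[X in - X = _]/(formB (nabla _ _) (Phi y)) -sa.
by rewrite (levi_civita_square _ _ lc) opprK.
Qed.

(** The weak equation is tested against each basis vector, with the velocity [Phi^-1 z] expanded
    through the eigenvalues; the bracket table then leaves the differences of the [nu]. *)
Lemma lax_integral gamma J : geodesic q gamma J -> integral_curve E (lax gamma) J.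
Proof.
move=> geo; case: (geo) => oJ _; split => // t Jt; apply: is_derive_mx => i l; rewrite ord1.
case: (adb) => _ [e1 e2 e3] [n1 n2 n3] [p1 p2 p3] [b1 b2 b3].
have dB y := geodesic_formB y geo Jt.
set x := velocity gamma t in dB; set z := Phi x in dB.
have [zE _] := adapted_coord z.
have xE : x = (nu1 * formB z v1) *: v1 + (nu2 * formB z v2) *: v2 + (nu3 * - formB z v3) *: v3.
  have lin (c1 c2 c3 : R) : (Phi^-1)%VF (c1 *: v1 + c2 *: v2 + c3 *: v3) =
      (nu1 * c1) *: v1 + (nu2 * c2) *: v2 + (nu3 * c3) *: v3.
    by rewrite !linearD !linearZ /= e1 e2 e3 !scalerA (mulrC c1) (mulrC c2) (mulrC c3).
  by rewrite -lin -zE PhiK.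
have b21 : sl2_bracket v2 v1 = - v3 by rewrite bracketC b1.
have b31 : sl2_bracket v3 v1 = - v2 by rewrite bracketC b2.
have b32 : sl2_bracket v3 v2 = v1 by rewrite bracketC b3 opprK.
have br y : formB z (sl2_bracket x y) = nu1 * formB z v1 * formB z (sl2_bracket v1 y) +
    nu2 * formB z v2 * formB z (sl2_bracket v2 y) - nu3 * formB z v3 * formB z (sl2_bracket v3 y).
  rewrite formBC {1}xE !bracketDl !bracketZl !formBDl !formBZl.
  by rewrite !(formBC _ z); ring.
have z0 : formB z 0 = 0 by rewrite formBC -(scale0r (0 : sl2 R)) formBZl mul0r.
have zN y : formB z (- y) = - formB z y by rewrite formBC formBNl formBC.
have [L0 L1 L2] := lax_coords gamma t; rewrite -/x -/z in L0 L1 L2.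
have ext (f g : R -> R) (d e : R) : is_derive t 1 f d -> f = g -> d = e -> is_derive t 1 g e.
  by move=> h <- <-.
have laxE (W : 'rV[R]_3) : W 0 (inord 0) = formB z v1 -> W 0 (inord 1) = formB z v2 ->
    W 0 (inord 2) = - formB z v3 -> E W = vec3 ((nu2 - nu3) * formB z v2 * - formB z v3)
    ((nu3 - nu1) * formB z v1 * - formB z v3) ((nu2 - nu1) * formB z v1 * formB z v2).
  by move=> W0 W1 W2; rewrite /lax_field W0 W1 W2.
rewrite (laxE _ L0 L1 L2); move: (vec3E ((nu2 - nu3) * formB z v2 * - formB z v3)
    ((nu3 - nu1) * formB z v1 * - formB z v3) ((nu2 - nu1) * formB z v1 * formB z v2)).
move: (vec3 _ _ _) => V [V0 V1 V2].
case: (I3_cases l) => ->; [rewrite V0|rewrite V1|rewrite V2].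
- apply: ext (dB v1) _ _; first by apply/funext => s; have [h _ _] := lax_coords gamma s; exact: esym h.
  by rewrite br bracketxx b21 b31 z0 !zN; ring.
- apply: ext (dB v2) _ _; first by apply/funext => s; have [_ h _] := lax_coords gamma s; exact: esym h.
  by rewrite br bracketxx b1 b32 z0; ring.
- apply: ext (is_derive_funZ (-1) (dB v3)) _ _.
    by apply/funext => s; have [_ _ h] := lax_coords gamma s; rewrite mulN1r; exact: esym h.
  by rewrite br bracketxx b2 b3 z0 zN; ring.
Qed.

Lemma velocity_eq gamma t s : lax gamma t = lax gamma s -> velocity gamma t = velocity gamma s.
Proof.
move=> e; apply: (can_inj PhiK).
have [L0 L1 L2] := lax_coords gamma t; have [M0 M1 M2] := lax_coords gamma s.
have ei i := congr1 (fun M : 'rV[R]_3 => M 0 i) e.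
apply: adapted_ext; last apply: oppr_inj.
- exact: etrans (esym L0) (etrans (ei _) M0).
- exact: etrans (esym L1) (etrans (ei _) M1).
- exact: etrans (esym L2) (etrans (ei _) M2).
Qed.

(** [velocity] projects to traceless matrices, so it has to be checked that [gamma^-1 gamma'] is
    traceless: its trace is the derivative of [\det gamma], which is constantly [1] near [t]. *)
Lemma geodesic_derive gamma J t : geodesic q gamma J -> J t ->
  is_derive t 1 gamma (gamma t *m vsval (velocity gamma t)).
Proof.
move=> [[oJ _ _] [nabla lc geo]] Jt; have [d1 dg _] := geo t Jt.
have gu : gamma t \in unitmx by rewrite unitmxE d1 unitr1.
set X := invmx (gamma t) *m 'D_1 gamma t.
have DE : 'D_1 gamma t = gamma t *m X by rewrite mulKVmx.
have dgt : is_derive t 1 gamma (gamma t *m X) by apply: DeriveDef => //.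
suff X0 : X \in sl2V R by rewrite /velocity -/X vsprojK.
rewrite mem_sl2V; apply/eqP.
have d i j := is_derive_coord i j dgt.
have ddet : is_derive t 1 (fun s => gamma s 0 0 * gamma s 1 1 + -1 * (gamma s 0 1 * gamma s 1 0))
    (\tr X * \det (gamma t)).
  apply: (is_derive_eq (is_derive_funD (is_derive_funM (d 0 0) (d 1 1))
    (is_derive_funZ _ (is_derive_funM (d 0 1) (d 1 0))))).
  by rewrite mxtrace2E det2E !mulmx2E; ring.
have d0 : is_derive t 1 (fun s => gamma s 0 0 * gamma s 1 1 + -1 * (gamma s 0 1 * gamma s 1 0)) (0 : R).
  apply: (@near_eq_is_derive _ _ _ (fun=> 1 : R)).
  apply: filterS (open_nbhs_nbhs (conj oJ Jt)) => s Js.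
  have [h _ _] := geo s Js; transitivity (\det (gamma s)); first by rewrite h.
  by rewrite det2E; ring.
have := @derive_val _ _ _ _ _ _ _ ddet; rewrite (@derive_val _ _ _ _ _ _ _ d0) d1 mulr1.
by move=> <-.
Qed.

(** [G] is the translate by [gamma t0] of the one-parameter group of [X], a geodesic on all of [R]
    that agrees with [gamma] on [J]. *)
Lemma constant_velocity_complete gamma J t0 : maximal_geodesic q gamma J -> J t0 ->
  (forall t, J t -> velocity gamma t = velocity gamma t0) -> J = setT.
Proof.
move=> [geo gmax] Jt0 vc; case: (geo) => -[oJ itvJ _] [nabla lc Hgeo].
set x := velocity gamma t0 in vc; set X := vsval x.
have X0 : \tr X = 0 by exact: sl2_traceless.
have dgam t : J t -> is_derive t 1 gamma (gamma t *m X).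
  by move=> Jt; have := geodesic_derive geo Jt; rewrite vc.
have XX := traceless_sqr X0; set K := - \det X in XX.
have [C [S CS]] := trig_pair_ex K; case: (CS) => dC dS C0 S0.
pose G t := C (t - t0) *: gamma t0 + S (t - t0) *: (gamma t0 *m X).
have GE t : G t = gamma t0 *m ((C (t - t0))%:M + S (t - t0) *: X).
  by rewrite /G mulmxDr mul_mx_scalar -scalemxAr.
have GX t : G t *m X = (K * S (t - t0)) *: gamma t0 + C (t - t0) *: (gamma t0 *m X).
  rewrite /G mulmxDl -!scalemxAl -mulmxA XX mul_mx_scalar scalerA.
  by rewrite addrC (mulrC K).
have dG t : is_derive t 1 G (G t *m X).
  have dC' := is_derive_shift (dC (t - t0)); have dS' := is_derive_shift (dS (t - t0)).
  apply: is_derive_mx => i j.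
  rewrite (_ : (fun s => _) = fun s => gamma t0 i j * C (s - t0) + (gamma t0 *m X) i j * S (s - t0)); last first.
    by apply/funext => s; rewrite /G !mxE; congr (_ + _); rewrite mulrC.
  apply: (is_derive_eq (is_derive_funD (is_derive_funZ _ dC') (is_derive_funZ _ dS'))).
  by rewrite GX [RHS]mxE; congr (_ + _); rewrite [RHS]mxE; ring.
have detG t : \det (G t) = 1.
  have [d1 _ _] := Hgeo t0 Jt0.
  rewrite GE det_mulmx d1 mul1r det_scalar_add // -(trig_pair_sqr CS (t - t0)) /K.
  ring.
have vG t : velocity G t = x.
  rewrite /velocity (@derive_val _ _ _ _ _ _ _ (dG t)) mulKmx ?unitmxE ?detG ?unitr1 //.
  exact: vsvalK.
(* The geodesic equation at [t0] for a constant velocity; this is what makes [G] a geodesic. *)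
have n0 : vsval (nabla x x) = 0.
  have [_ _] := Hgeo t0 Jt0; rewrite -/x => h1.
  have h2 : is_derive t0 1 (fun s => vsval (velocity gamma s)) (0 : 'M[R]_2).
    apply: (@near_eq_is_derive _ _ _ (fun=> vsval x)).
    by apply: filterS (open_nbhs_nbhs (conj oJ Jt0)) => s Js; rewrite vc.
  have := @derive_val _ _ _ _ _ _ _ h1; rewrite (@derive_val _ _ _ _ _ _ _ h2) => h.
  by apply/eqP; rewrite -oppr_eq0 -h.
apply/esym; apply: (gmax G) => //.
- split; first by split => //; [exact: openT|exists 0].
  exists nabla => // t _; split; first exact: detG.
    by have := dG t => ?; exact: ex_derive.
  rewrite vG n0 oppr0 (_ : (fun s => _) = fun=> vsval x); last by apply/funext => s; rewrite vG.
  exact: is_derive_cst.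
(* Each entry of [gamma] satisfies [h'' = K h], because [gamma'' = gamma X^2 = K gamma], so
   [linear2_sol] identifies it with the entry of [G]. *)
- move=> t Jt; apply/matrixP => i j.
  have [||-> _] := @linear2_sol _ K C S CS (fun s => gamma s i j) (fun s => (gamma s *m X) i j) J t0 itvJ Jt0 _ _ t Jt.
  + by move=> s Js; exact: (is_derive_coord i j (dgam s Js)).
  + move=> s Js; have d m n := is_derive_coord m n (dgam s Js).
    rewrite (_ : (fun s => _) = fun s => X 0 j * gamma s i 0 + X 1 j * gamma s i 1); last first.
      by apply/funext => u; rewrite mulmx2E; ring.
    apply: (is_derive_eq (is_derive_funD (is_derive_funZ _ (d i 0)) (is_derive_funZ _ (d i 1)))).
    transitivity ((gamma s *m X *m X) i j); first by rewrite [RHS]mulmx2E; ring.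
    by rewrite -mulmxA XX mul_mx_scalar mxE.
  + by rewrite [LHS]mxE; congr (_ + _); rewrite [LHS]mxE mulrC.
Qed.

End AdaptedBasis.

(** The derivative of the remaining coordinate is a multiple of the product of the two vanishing
    ones. *)
Lemma axis_constant (R : realType) (a b c : R) (mu : 'I_3 -> R)
    (w : R -> 'rV[R]_3) (J : set R) (k : 'I_3) :
  is_scaling a b c mu -> integral_curve (lax_field a b c) w J ->
  (forall t, J t -> forall l, l != k -> w t 0 l = 0) ->
  forall s t, J s -> J t -> w s = w t.
Proof.
move=> muP wJ ax s t Js Jt; case: (muP) => mu0 _ _; case: (wJ) => -[_ itvJ _] _.
apply/rowP => l; have [->|lk] := eqVneq l k; last by rewrite !ax.
have [m [n U]] := uniq3_ex k; apply: (mulfI (mu0 k)).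
apply: (@derive0_const _ (fun t => mu k * w t 0 k) J) => // u Ju.
apply: (is_derive_eq (lax_euler muP wJ U Ju)).
by move: U; rewrite uniq3E => /and3P[km _ _]; rewrite ax 1?eq_sym // mulr0 mul0r.
Qed.

Theorem proposition6p4 (R : realType) (q : {symmetric (sl2 R)})
    (Phi : 'End(sl2 R)) (v1 v2 v3 : sl2 R) (nu1 nu2 nu3 a b c : R)
    (z : R -> 'rV[R]_3) (I : set R) (gamma : R -> 'M[R]_2) (J : set R) :
  nondegenerate q ->
  associated_isomorphism q Phi ->
  has_eigenbasis Phi ->
  adapted_basis Phi v1 v2 v3 nu1 nu2 nu3 ->
  a = nu2 - nu3 -> b = nu3 - nu1 -> c = nu2 - nu1 ->
  0 < a * b ->
  maximal_integral_curve (lax_field a b c) z I ->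
  let L := z @` I in
  ~ L 0 ->
  maximal_geodesic q gamma J ->
  lax_curve Phi v1 v2 v3 gamma @` J = L ->
  let Linf := @rp_class R @` L in
  [/\ (reduces_to Linf qx \/ reduces_to Linf qy \/ reduces_to Linf qu ->
        geod_complete J),
      (~ (reduces_to Linf qx \/ reduces_to Linf qy \/ reduces_to Linf qu) ->
        ~ geod_complete J) &
      (~ geod_complete J ->
        (geod_complete_pos J \/ geod_complete_neg J <->
          (exists p r, [/\ p_points a b c p, q_points r &
                           joins (fun t => rp_class (z t)) I p r]) \/
          (exists2 p, p_points a b c p & reduces_to Linf p)))].
Proof.
move=> _ qPhi _ adb aE bE cE ab0 zmax L L0 gmax lz Linf.
have cab : c = a + b by rewrite aE bE cE; ring.
have [mu muP] := lax_scaling ab0 cab.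
case: (gmax) => geo _; case: (geo) => -[_ _ [t0 Jt0]] _.
have wJ : integral_curve (lax_field a b c) (lax_curve Phi v1 v2 v3 gamma) J.
  by rewrite aE bE cE; exact: (lax_integral qPhi adb).
have Lneq0 v : L v -> v != 0 by move=> Lv; apply/eqP => v0; apply: L0; rewrite -v0.
have onL t : J t -> L (lax_curve Phi v1 v2 v3 gamma t) by rewrite -lz; exists t.
(* This depends on [L] only, so it can be read off the trajectory as well as off the Lax curve of
   the geodesic. *)
pose axis := exists k : 'I_3, forall v, L v -> forall l, l != k -> v 0 l = 0.
have axisP : axis <-> reduces_to Linf qx \/ reduces_to Linf qy \/ reduces_to Linf qu.
  split=> [[k ax]|red].
    have red : reduces_to Linf (rp_class (delta_mx 0 k)).
      apply/seteqP; split => [_ [v Lv <-]|_ ->] /=.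
        by apply/(rp_class_deltaP _ (Lneq0 _ Lv)); exact: ax.
      exists (lax_curve Phi v1 v2 v3 gamma t0); first exact: onL.
      by apply/(rp_class_deltaP _ (Lneq0 _ (onL _ Jt0))); apply: ax; exact: onL.
    have : q_points (rp_class (delta_mx 0 k : 'rV[R]_3)) by apply/q_pointsP; exists k.
    by move=> [[]|] e; rewrite e in red; [left|right; left|right; right].
  have [r [qr {}red]] : exists r, q_points r /\ reduces_to Linf r.
    by case: red => [|[]] red; [exists qx|exists qy|exists qu]; split => //;
      [left; left|left; right|right].
  move: qr red => /q_pointsP[k ->] red; exists k => v Lv.
  apply/(rp_class_deltaP _ (Lneq0 _ Lv)).
  have : [set rp_class (delta_mx 0 k : 'rV[R]_3)] (rp_class v) by rewrite -red; exists v.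
  by [].
(* On an axis the Lax curve is constant, and it determines the velocity because [Phi] is
   invertible. *)
have axis_complete : axis -> J = setT.
  move=> [k ax]; apply: (constant_velocity_complete gmax Jt0) => t Jt.
  apply: (velocity_eq qPhi adb).
  by apply: (axis_constant muP wJ) => // s Js; apply: ax; exact: onL.
have complete_axis : J = setT -> axis.
  move=> JT; rewrite JT in wJ onL lz.
  have [|k ax] := complete_axis muP wJ; first by move=> t; apply: Lneq0; exact: onL.
  by exists k => v; rewrite -lz => -[t _ <-]; exact: ax.
split.
- by move=> /axisP; exact: axis_complete.
- by move=> nred /complete_axis /axisP.
- move=> nJ; have noaxis : ~ axis by move=> /axis_complete.
  split; first exact: (unbounded_joins muP zmax wJ lz L0 noaxis).
  exact: (joins_unbounded muP zmax wJ lz L0 noaxis).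
Qed.
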